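(* Let $m\ge 2$ be an integer, $a>0$, $\theta>1$, $\sigma>1$ real numbers, and let $Q$, $q$, $b_1,\dots,b_{m-1}$, $h$ be as in the context; in particular $$(-1)^m Q(r,t_0,\ldots,t_{m-1})\ \ge\ q(r)h(t_0)-\sum_{i=1}^{m-1}b_i(r)|t_i|$$ whenever $r\ge a$, $t_0>0$ and $(-1)^i t_i\ge 0$ for $i=1,\ldots,m-1$. Let $g$, $f$ be the functions defined in the context. Suppose that $$\int_0^1 g^{-1/m}(t)\,t^{1/m-1}\,dt=\infty,\qquad \int_a^\infty \xi^{m-1} f(\xi)\,d\xi=\infty,$$ and, moreover, $$L:=\limsup_{r\to\infty}\frac{r^m f(r)}{\int_a^r\xi^{m-1}f(\xi)\,d\xi}<\infty .$$ Then any solution $w$ of the problem $$w^{(m)}=Q(r,w,\ldots,w^{(m-1)}),\quad r\ge a,\qquad (-1)^i w^{(i)}(r)\ge 0,\quad r\ge a,\ i=0,\ldots,m-1,$$ satisfies the estimate $$w(r)\le G_0^{-1}\left(C\left(\int_a^r\xi^{m-1}f(\xi)\,d\xi\right)^{1/m}\right)$$ for all sufficiently large $r$, where $G_0^{-1}$ is the function inverse to $$G_0(\xi)=\int_\xi^1 g^{-1/m}(t)\,t^{1/m-1}\,dt,$$ and the constant $C>0$ depends only on $m$, $\theta$, $\sigma$ and $L$.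
   Context: Setting. $Q:[a,\infty)\times\mathbb R^m\to\mathbb R$ belongs to the Caratheodory class $K_{loc}([a,\infty)\times\mathbb R^m)$: $Q(\cdot,t)$ is measurable for every $t\in\mathbb R^m$, $Q(r,\cdot)$ is continuous for almost every $r$, and for every $\rho>0$ the function $r\mapsto\sup_{|t|\le\rho}|Q(r,t)|$ is integrable on every compact subinterval of $[a,\infty)$. The functions $q:[a,\infty)\to[0,\infty)$ and $b_i:[a,\infty)\to[0,\infty)$, $i=1,\ldots,m-1$, belong to $L_{\infty,loc}([a,\infty))$ (measurable and essentially bounded on compact subintervals), and $h:(0,\infty)\to(0,\infty)$ is continuous. Solutions. A function $w:[a,\infty)\to\mathbb R$ is a solution of the problem if $w^{(i)}$, $i=0,\ldots,m-1$, are locally absolutely continuous on $[a,\infty)$, the equation holds for almost all $r\in[a,\infty)$, and the sign conditions hold for all $r\in[a,\infty)$. Notation. For the fixed (arbitrarily chosen) real numbers $\theta>1$, $\sigma>1$: $$g(t)=\inf_{(t/\theta,\,\theta t)}h,\quad t\in(0,\infty),$$ $$f(r)=\frac{q(r)}{1+\sum_{i=1}^{m-1}r^{m-i}\,\operatorname{ess\,sup}_{(r/\sigma,\,r\sigma)\cap[a,\infty)}b_i},\quad r\in[a,\infty).$$ The function $G_0$ is considered for $\xi\in(0,\infty)$; it is strictly decreasing there. *)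

(* Defs.v *)
From HB Require Import structures.
From mathcomp Require Import all_boot all_order all_algebra.
From mathcomp Require Import all_classical all_reals all_analysis.

Set Implicit Arguments.
Unset Strict Implicit.
Unset Printing Implicit Defensive.

Import Order.TTheory GRing.Theory Num.Theory.
Import numFieldNormedType.Exports.

Local Open Scope classical_set_scope.
Local Open Scope ring_scope.

(* "Measurable", "almost every" and the integrals refer to the complete
   Lebesgue sigma-algebra, not to the Borel one that R carries by default.
   R with that sigma-algebra is convertible to R. *)
Notation lebR R := (caratheodory_type ((wlength (@idfun R))^*)%mu).
Notation leb := (@completed_lebesgue_measure _).

Section Defs.
Context {R : realType}.
Implicit Types (a r : R) (m : nat) (f h q w : R -> R) (b : nat -> R -> R).

(* The domain type is given explicitly: it would be inferred as Borel R. *)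
Definition leb_measurable_fun (A : set R) f : Prop :=
  @measurable_fun _ _ (lebR R) R A f.

Definition Linfty_loc a f : Prop :=
  leb_measurable_fun `[a, +oo[ f /\
  forall c d, a <= c -> c <= d ->
    exists M : R, {ae leb, forall r : R, c <= r <= d -> `|f r| <= M}.

Definition euclid_norm m (t : 'rV[R]_m) : R :=
  Num.sqrt (\sum_(i < m) t 0 i ^+ 2).

Definition K_loc m a (Q : R -> 'rV[R]_m -> R) : Prop :=
  [/\ forall t, leb_measurable_fun `[a, +oo[ (Q ^~ t),
      {ae leb, forall r : R, a <= r -> continuous (Q r)} &
      forall rho : R, 0 < rho -> forall c d, a <= c -> c <= d ->
        leb.-integrable `[c, d] (fun r => ereal_sup
          [set `|Q r t|%:E | t in [set t | euclid_norm t <= rho]])].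

Definition abs_cont (c d : R) w : Prop :=
  forall e : R, 0 < e -> exists2 delta : R, 0 < delta &
    forall (n : nat) (u v : 'I_n -> R),
      (forall i, c <= u i /\ u i <= v i /\ v i <= d) ->
      trivIset setT (fun i => `]u i, v i[%classic) ->
      \sum_(i < n) (v i - u i) < delta ->
      \sum_(i < n) `|w (v i) - w (u i)| < e.

Definition loc_abs_cont a w : Prop :=
  forall c d, a <= c -> c <= d -> abs_cont c d w.

(* Derivative of w seen as a function on [a, +oo[: one-sided at r = a. *)
Definition has_deriv_on a w r (l : R) : Prop :=
  (w x - w r) / (x - r) @[x --> within `[a, +oo[ r^'] --> l.

(* W i is the i-th derivative of w, 0 <= i <= m - 1. *)
Definition solution m a (Q : R -> 'rV[R]_m -> R) w : Prop :=
  exists W : nat -> R -> R,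
  [/\ W 0%N = w,
      forall i, (i.+1 < m)%N ->
        forall r, a <= r -> has_deriv_on a (W i) r (W i.+1 r),
      forall i, (i < m)%N -> loc_abs_cont a (W i),
      {ae leb, forall r : R, a <= r ->
        has_deriv_on a (W m.-1) r (Q r (\row_(i < m) W i r))} &
      forall i, (i < m)%N -> forall r, a <= r -> 0 <= (-1) ^+ i * W i r].

(* Only the values t i with i < m matter. *)
Definition growth_condition m a (Q : R -> 'rV[R]_m -> R) q b h : Prop :=
  forall r (t : nat -> R), a <= r -> 0 < t 0%N ->
    (forall i, (1 <= i < m)%N -> 0 <= (-1) ^+ i * t i) ->
    q r * h (t 0%N) - \sum_(1 <= i < m) b i r * `|t i|
      <= (-1) ^+ m * Q r (\row_(i < m) t i).

Definition ess_sup_on (D : set R) f : \bar R :=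
  ereal_inf [set y | {ae leb, forall r : R, D r -> ((f r)%:E <= y)%E}].

Definition g_fun (theta : R) h (t : R) : R :=
  inf [set h s | s in `]t / theta, theta * t[].

Definition f_fun m (sigma : R) a q b r : R :=
  q r / (1 + \sum_(1 <= i < m) r ^+ (m - i) *
    fine (ess_sup_on (`]r / sigma, r * sigma[ `&` `[a, +oo[) (b i))).

Definition G0_integrand m (theta : R) h (t : R) : R :=
  g_fun theta h t `^ (- m%:R^-1) * t `^ (m%:R^-1 - 1).

(* Oriented integral from xi to 1. *)
Definition G0 m (theta : R) h (xi : R) : R :=
  let psi := G0_integrand m theta h in
  if xi <= 1 then \int[leb]_(t in `[xi, 1]) psi t
  else - \int[leb]_(t in `[1, xi]) psi t.

(* Meaningful on the range of G0 on ]0, +oo[. *)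
Definition G0_inv m (theta : R) h : R -> R :=
  pinv (`]0, +oo[%classic : set R) (G0 m theta h).

Definition F_integrand m (sigma : R) a q b (xi : R) : R :=
  xi ^+ m.-1 * f_fun m sigma a q b xi.

Definition F_int m (sigma : R) a q b r : R :=
  \int[leb]_(xi in `[a, r]) F_integrand m sigma a q b xi.

End Defs.

(* Main.v *)
Require Import Defs.
From HB Require Import structures.
From mathcomp Require Import all_boot all_order all_algebra.
From mathcomp Require Import all_classical all_reals all_analysis.
From mathcomp Require Import measurable_realfun ring lra.

Set Implicit Arguments.
Unset Strict Implicit.
Unset Printing Implicit Defensive.

Import Order.TTheory GRing.Theory Num.Theory.
Import numFieldNormedType.Exports.

Local Open Scope classical_set_scope.
Local Open Scope ring_scope.

(** Write D(s,r) = w(s) - w(r), F(r) for the integral of xi^(m-1) f(xi) over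
    [a,r], and Phi = F^(1/m).  If h(w) >= H on [s,r] with r <= kappa^2 s and
    kappa^2 < sigma, integrating the equation once and bounding the derivatives
    of w by mean values gives, for s < p < r,
      D(s,r) >= H ((p-s)/(m r))^(m-1) (F(r) - F(p)).
    Since r^m f <= L' F for large r, taking p with F(r) - F(p) >= (F(r) - F(s))/2
    turns this into D(s,r) >= c H (Phi(r) - Phi(s))^m, and chaining overlapping
    intervals of ratio kappa^2 removes the restriction r <= kappa^2 s.
    When w(s) = theta^(1/2) w(r), the minimum H of h on [w(r),w(s)] dominates g
    there, so G_0(w(r)) - G_0(w(s)) >= c' (Phi(r) - Phi(s)) with c' depending
    only on m, theta, kappa and L'.  Summing over such steps,
    G_0(w(r)) >= c' Phi(r) - K, and Phi tends to infinity. *)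

(** * Absolute continuity and monotonicity *)

(** The lower order terms may give $(-1)^m Q$ the wrong sign, so $w^{(m-1)}$ need not be monotone.
    The window in f pays for this. If r < sigma s, the window of every x in [s,r] contains [s,r]; so
    constants beta_i that bound the b_i almost everywhere on [s,r] make B = 1 + sum s^(m-i) beta_i
    at most the denominator of f(x), that is, B f <= q. Bounding the derivatives by mean values
    costs a factor at most B as well, and B cancels. The ratio theta^(1/2) has the same origin: any
    two points of an interval of that ratio lie in each other's window for g. Absolute continuity
    enters through one-sided inequalities only. A derivative that is nonpositive almost everywhere
    forces monotonicity, and for a monotone function Fatou's lemma bounds the integral of minus the
    derivative by the drop. The finite limsup bounds the growth of F on a logarithmic scale, which
    places p at a controlled distance from s. The number K depends on the solution, but half of c'
    Phi eventually absorbs it; so C does not. *)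

Section AbsCont.
Context {R : realType}.
Implicit Types (P Q : R -> R) (c d x : R).

(* Instance search does not see through the conversion of R with [lebR R]. *)
#[export] Instance ae_leb_filter :
  @Filter R (nbhs (almost_everywhere (@completed_lebesgue_measure R))).
Proof. exact: (@ae_filter_ringOfSetsType _ (lebR R) R leb). Qed.

(** Differentiability with the denominator cleared: [y = x] is no exception, and such estimates can
    be added directly. *)
Definition deriv_at P x (l : R) : Prop :=
  forall e : R, 0 < e -> exists2 delta : R, 0 < delta &
    forall y, `|y - x| < delta -> `|P y - P x - l * (y - x)| <= e * `|y - x|.

Lemma ae_fail_open (G : R -> Prop) (delta : R) : 0 < delta ->
  {ae leb, forall x : R, G x} ->
  exists U : set R, [/\ open U, forall x, ~ G x -> U x &
    (lebesgue_measure U < delta%:E)%E].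
Proof.
move=> d0 [A [mA A0 GA]].
have d20 : 0 < delta / 2 by lra.
have [U [oU AU hU]] := outer_measure_open_le A d20.
exists U; split => //; first by move=> x Gx; apply/AU/GA.
apply: (le_lt_trans hU).
have -> : ((wlength (@idfun R))^* A)%mu = 0%E by exact: A0.
by rewrite add0e lte_fin; lra.
Qed.

Lemma ae_neq c : {ae leb, forall x : R, x <> c}.
Proof.
have h : lebesgue_measure [set c] = 0%E := lebesgue_measure_set1 c.
exists [set c]; split.
- by apply: sub_caratheodory; exact: measurable_set1.
- exact: h.
- by move=> x /= /contrapT ->.
Qed.

(** Continuous induction along [[c, d]]. Good points are crossed at slope at most [e]; bad points
    are crossed inside an open set of measure below [delta], where absolute continuity keeps the
    total increment below [e]. *)
Lemma abs_cont_nonincreasing c d P : c <= d -> abs_cont c d P ->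
  {ae leb, forall x : R, c < x < d -> exists2 l, l <= 0 & deriv_at P x l} ->
  P d <= P c.
Proof.
move=> cd acP aeP.
suff main e : 0 < e -> P d - P c <= e * (d - c) + e.
  apply/ler_addgt0Pr => e e0.
  have e1 : 0 < e / (d - c + 1) by apply: divr_gt0 => //; lra.
  have := main _ e1.
  have -> : e / (d - c + 1) * (d - c) + e / (d - c + 1) = e by field; lra.
  by lra.
move=> e0; have [delta d0 hdelta] := acP e e0.
(* The endpoints join the exceptional set, because differentiability is given only inside []c,
   d[]. *)
have /(ae_fail_open d0)[U [oU GU muU]] : {ae leb, forall x : R,
    (x <> c /\ x <> d) /\
    (c < x < d -> exists2 l, l <= 0 & deriv_at P x l)}.
  by apply: filterS3 (ae_neq c) (ae_neq d) aeP.
pose mu : {measure set _ -> \bar R} := @lebesgue_measure R.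
(* The lengths of the intervals are charged to the part of [U] to the left of [y], so that at
   [y = d] their total is below [delta]. *)
pose T y := exists n (u v : nat -> R), [/\
  forall i, (i < n)%N -> c <= u i /\ u i <= v i /\ v i <= y,
  forall i j, (i < j < n)%N -> v i <= u j,
  ((\sum_(i < n) (v i - u i))%:E <= mu (U `&` `[c, y[))%E &
  P y - P c <= e * (y - c) + \sum_(i < n) `|P (v i) - P (u i)|].
suff [n [u [v [h1 h2 h3 h4]]]] : T d.
  apply: (le_trans h4); rewrite lerD2l; apply/ltW.
  apply: (hdelta n (fun i => u i) (fun i => v i)).
  - by move=> i; exact: h1.
  - move=> i j _ _ [x [/=]]; rewrite !in_itv/= => /andP[ui vi] /andP[uj vj].
    apply/val_inj; case: (ltngtP i j) => // ij; exfalso.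
    + by have := h2 i j; rewrite ij ltn_ord/= => /(_ isT); lra.
    + by have := h2 j i; rewrite ij ltn_ord/= => /(_ isT); lra.
  - rewrite -lte_fin; apply: (le_lt_trans h3); apply: le_lt_trans muU.
    by apply: le_outer_measure => x [].
have Tc : T c.
  exists 0%N, (fun=> 0), (fun=> 0); split => //.
  - by rewrite big_ord0; exact: (@measure_ge0 _ _ _ mu).
  - by rewrite big_ord0 !subrr mulr0 addr0.
pose S := [set y | c <= y <= d /\ T y].
have Sc : S c by split => //; rewrite lexx cd.
have Sub : ubound S d by move=> y [/andP[]].
have supS : has_sup S by split; [exists c|exists d].
set ys := sup S.
have cys : c <= ys by apply: sup_upper_bound.
have ysd : ys <= d by apply: ge_sup => //; exists c.
suff [eta eta0 Ty'] : exists2 eta, 0 < eta & T (Num.min d (ys + eta)).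
  have [dy|yd] := leP d (ys + eta); first by rewrite min_l // in Ty'.
  rewrite min_r in Ty'; last exact: ltW.
  have : ys + eta <= ys by apply: sup_upper_bound => //; split => //; lra.
  by lra.
have adh eta : 0 < eta -> exists y1, [/\ ys - eta < y1, y1 <= ys, c <= y1 & T y1].
  move=> eta0; have [y1 Sy1 hy1] := sup_adherent eta0 supS.
  exists y1; split => //; first exact: sup_upper_bound.
    by case: Sy1 => /andP[].
  by case: Sy1.
(* If the supremum lies in [U], one more interval, from just below it to just above it, is
   appended. *)
have [Uys|nUys] := pselect (U ys).
  have /nbhs_ballP[eta /= eta0 hU] := open_nbhs_nbhs (conj oU Uys).
  have [y1 [y1l y1u cy1 [n [u [v [h1 h2 h3 h4]]]]]] := adh _ eta0.
  exists (eta / 2); first by lra.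
  set y' := Num.min d (ys + eta / 2).
  have y1y' : y1 <= y' by rewrite /y' le_min; apply/andP; split; lra.
  have y'u : y' <= ys + eta / 2 by rewrite /y' ge_min lexx orbT.
  exists n.+1, (fun i => if (i < n)%N then u i else y1),
    (fun i => if (i < n)%N then v i else y'); split.
  - move=> i _; case: ifP => [/h1|_]; lra.
  - move=> i j /andP[ij]; rewrite ltnS => jn; have in_ := leq_trans ij jn.
    rewrite in_; case: ifP => jn'; first by apply: h2; rewrite ij.
    by have := h1 _ in_; lra.
  - rewrite big_ord_recr/= ltnn.
    under eq_bigr do rewrite ltn_ord.
    rewrite EFinD.
    have -> : U `&` `[c, y'[ = (U `&` `[c, y1[) `|` `[y1, y'[.
      apply/seteqP; split => x /=; rewrite !in_itv/=.
        by move=> [Ux /andP[cx xy]]; have [?|?] := ltP x y1; [left|right];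
          rewrite ?cx ?xy.
      move=> [[Ux /andP[cx xy]]|/andP[yx xy]].
        by split => //; rewrite cx (lt_le_trans xy).
      split; last by rewrite (le_trans cy1 yx).
      by apply: hU; rewrite /ball/= ltr_norml; lra.
    rewrite measureU//.
    + apply: leeD => //.
      have : ((y' - y1)%:E <= lebesgue_measure `[y1, y'[)%E.
        rewrite lebesgue_measure_itv/= lte_fin.
        by case: ltP => // y'y1; rewrite lee_fin subr_le0.
      exact.
    + by apply: measurableI => //; exact: open_measurable.
    + rewrite -subset0 => x [/= [_]]; rewrite !in_itv/=.
      by move=> /andP[_ xy] /andP[yx _]; lra.
  - rewrite big_ord_recr/= ltnn.
    under eq_bigr do rewrite ltn_ord.
    have : 0 <= e * (y' - y1) by apply: mulr_ge0; lra.
    by have := ler_norm (P y' - P y1); lra.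
(* Otherwise the derivative at the supremum is nonpositive, and passing it costs slope [e] without a
   new interval. *)
have [[/eqP ysc /eqP ysnd] gd] := contrapT (contra_not (GU ys) nUys).
have ys_in : c < ys < d by rewrite !lt_neqAle cys ysd ysnd eq_sym ysc.
have [l l0 hl] := gd ys_in.
have [eta eta0 heta] := hl _ e0.
have [y1 [y1l y1u cy1 [n [u [v [h1 h2 h3 h4]]]]]] := adh _ eta0.
exists (eta / 2); first by lra.
set y' := Num.min d (ys + eta / 2).
have ysy' : ys <= y' by rewrite /y' le_min; apply/andP; split; lra.
have y'u : y' <= ys + eta / 2 by rewrite /y' ge_min lexx orbT.
exists n, u, v; split => //.
- by move=> i /h1; lra.
- apply: (le_trans h3); apply: le_outer_measure => x [Ux] /=; rewrite !in_itv/=.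
  by move=> /andP[cx xy]; split => //; rewrite cx; lra.
- have := heta y'; rewrite ger0_norm ?subr_ge0// ler_norml => /(_ _)/andP[|_ k1].
    by lra.
  have := heta y1; rewrite ler0_norm ?subr_le0// ler_norml => /(_ _)/andP[|k2 _].
    by lra.
  have : l * (y' - ys) <= 0 by apply: mulr_le0_ge0; lra.
  have : 0 <= l * (y1 - ys) by apply: mulr_le0; lra.
  by lra.
Qed.

End AbsCont.

(** * Linear combinations of differentiable and of absolutely continuous functions *)

Section DerivativesAndAbsoluteContinuity.
Context {R : realType}.
Implicit Types (P Q : R -> R) (c d x : R).

Lemma deriv_at_cst (k : R) x : deriv_at (fun=> k) x 0.
Proof.
move=> e e0; exists 1 => // y _.
by rewrite subrr mul0r subr0 normr0 mulr_ge0// ltW.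
Qed.

Lemma deriv_at_id x : deriv_at id x 1.
Proof.
move=> e e0; exists 1 => // y _.
by rewrite mul1r subrr normr0 mulr_ge0// ltW.
Qed.

Lemma deriv_at_addZ P Q x l k (a : R) : deriv_at P x l -> deriv_at Q x k ->
  deriv_at (fun y => P y + a * Q y) x (l + a * k).
Proof.
move=> dP dQ e e0.
have a1 : 0 < `|a| + 1 by rewrite ltr_wpDl.
have e1 : 0 < e / 2 by rewrite divr_gt0.
have e2 : 0 < e / 2 / (`|a| + 1) by rewrite divr_gt0.
have [d1 d10 h1] := dP _ e1; have [d2 d20 h2] := dQ _ e2.
exists (Num.min d1 d2); first by rewrite lt_min d10.
move=> y; rewrite lt_min => /andP[/h1 k1 /h2 k2].
have -> : P y + a * Q y - (P x + a * Q x) - (l + a * k) * (y - x) =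
  (P y - P x - l * (y - x)) + a * (Q y - Q x - k * (y - x)) by ring.
apply: (le_trans (ler_normD _ _)).
rewrite [e]splitr mulrDl; apply: lerD => //.
rewrite normrM; apply: (@le_trans _ _ ((`|a| + 1) * (e / 2 / (`|a| + 1) * `|y - x|))).
  by apply: ler_pM => //; rewrite lerDl.
by rewrite mulrA [(`|a| + 1) * _]mulrC divfK// gt_eqF.
Qed.

Lemma deriv_at_sum (r : seq nat) (a : nat -> R) (P : nat -> R -> R)
    (l : nat -> R) x : (forall i, i \in r -> deriv_at (P i) x (l i)) ->
  deriv_at (fun y => \sum_(i <- r) a i * P i y) x (\sum_(i <- r) a i * l i).
Proof.
elim: r => [|i r IH] h.
  rewrite big_nil; under eq_fun do rewrite big_nil.
  exact: deriv_at_cst.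
rewrite big_cons addrC; under eq_fun do rewrite big_cons addrC.
apply: deriv_at_addZ; last by apply: h; rewrite mem_head.
by apply: IH => j jr; apply: h; rewrite in_cons jr orbT.
Qed.

(** A partition cell contains [x] without having it as an endpoint, so difference quotients around
    [x] are needed. *)
Lemma deriv_at_straddle P x l e : deriv_at P x l -> 0 < e ->
  exists2 delta : R, 0 < delta & forall u v, u <= x <= v -> v - u < delta ->
    `|P v - P u - l * (v - u)| <= e * (v - u).
Proof.
move=> dP e0; have [delta d0 h] := dP _ e0; exists delta => // u v /andP[ux xv] uv.
have hu : `|P u - P x - l * (u - x)| <= e * - (u - x).
  by have := h u; rewrite (ler0_norm (x := u - x)) ?subr_le0//; apply; lra.
have hv : `|P v - P x - l * (v - x)| <= e * (v - x).
  by have := h v; rewrite (ger0_norm (x := v - x)) ?subr_ge0//; apply; lra.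
have -> : P v - P u - l * (v - u) =
  (P v - P x - l * (v - x)) - (P u - P x - l * (u - x)) by ring.
apply: (le_trans (ler_normB _ _)).
have -> : e * (v - u) = e * (v - x) + e * - (u - x) by ring.
exact: lerD.
Qed.

Lemma abs_cont_sub c d u v P : c <= u -> v <= d -> abs_cont c d P ->
  abs_cont u v P.
Proof.
move=> cu vd acP e e0; have [delta d0 h] := acP e e0; exists delta => //.
move=> n a b hab; apply: h => i; have [h1 [h2 h3]] := hab i.
by rewrite (le_trans cu h1) h2 (le_trans h3 vd).
Qed.

Lemma abs_cont_cst c d (k : R) : abs_cont c d (fun=> k).
Proof.
move=> e e0; exists 1 => // n u v _ _ _; rewrite big1// => i _.
by rewrite subrr normr0.
Qed.

Lemma abs_cont_id c d : abs_cont c d id.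
Proof.
move=> e e0; exists e => // n u v h _; apply: le_lt_trans.
apply: ler_sum => i _; rewrite /= ger0_norm// subr_ge0.
by have [_ []] := h i.
Qed.

Lemma abs_cont_addZ c d P Q (a : R) : abs_cont c d P -> abs_cont c d Q ->
  abs_cont c d (fun y => P y + a * Q y).
Proof.
move=> dP dQ e e0.
have a1 : 0 < `|a| + 1 by rewrite ltr_wpDl.
have e1 : 0 < e / 2 by rewrite divr_gt0.
have e2 : 0 < e / 2 / (`|a| + 1) by rewrite divr_gt0.
have [d1 d10 h1] := dP _ e1; have [d2 d20 h2] := dQ _ e2.
exists (Num.min d1 d2); first by rewrite lt_min d10.
move=> n u v huv tuv; rewrite lt_min => /andP[/(h1 _ _ _ huv tuv) k1].
move=> /(h2 _ _ _ huv tuv) k2.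
apply: (@le_lt_trans _ _ (\sum_(i < n) `|P (v i) - P (u i)| +
    \sum_(i < n) (`|a| + 1) * `|Q (v i) - Q (u i)|)).
  rewrite -big_split; apply: ler_sum => i _ /=.
  have -> : P (v i) + a * Q (v i) - (P (u i) + a * Q (u i)) =
    (P (v i) - P (u i)) + a * (Q (v i) - Q (u i)) by ring.
  apply: (le_trans (ler_normD _ _)); rewrite lerD2l normrM.
  by apply: ler_wpM2r => //; rewrite lerDl.
rewrite -mulr_sumr [e]splitr; apply: ltrD => //.
by move: k2; rewrite ltr_pdivlMr// mulrC.
Qed.

Lemma abs_cont_sum (r : seq nat) (a : nat -> R) (P : nat -> R -> R) c d :
  (forall i, i \in r -> abs_cont c d (P i)) ->
  abs_cont c d (fun y => \sum_(i <- r) a i * P i y).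
Proof.
elim: r => [|i r IH] h.
  under [X in abs_cont _ _ X]eq_fun do rewrite big_nil.
  exact: abs_cont_cst.
under [X in abs_cont _ _ X]eq_fun do rewrite big_cons addrC.
apply: (@abs_cont_addZ _ _ (fun y => \sum_(j <- r) a j * P j y) (P i));
  last by apply: h; rewrite mem_head.
by apply: IH => j jr; apply: h; rewrite in_cons jr orbT.
Qed.

Lemma lipschitz_abs_cont c d (P : R -> R) M : 0 <= M ->
  (forall x y, c <= x -> x <= y -> y <= d -> `|P y - P x| <= M * (y - x)) ->
  abs_cont c d P.
Proof.
move=> M0 hP e e0; have M1 : 0 < M + 1 by rewrite ltr_wpDl.
exists (e / (M + 1)); first exact: divr_gt0.
move=> n u v huv _; rewrite ltr_pdivlMr// => hs.
apply: (@le_lt_trans _ _ (\sum_(i < n) (v i - u i) * (M + 1))); last first.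
  by rewrite -mulr_suml.
apply: ler_sum => i _; have [h1 [h2 h3]] := huv i.
apply: (le_trans (hP _ _ h1 h2 h3)); rewrite mulrC.
by apply: ler_wpM2l; [rewrite subr_ge0|rewrite lerDl].
Qed.

Lemma abs_cont_continuous c d P : abs_cont c d P ->
  {within `[c, d], continuous P}.
Proof.
move=> acP; apply/subspace_continuousP => x /=; rewrite in_itv/= => /andP[cx xd].
apply: (cvgrPdist_lt _ _).2 => e e0; have [delta d0 h] := acP e e0.
rewrite /prop_near1 /within/=; exists delta => //= y xy; rewrite in_itv/= => /andP[cy yd].
have := h 1%N (fun=> Num.min x y) (fun=> Num.max x y).
rewrite !big_ord1.
have [xley|yltx] := leP x y.
  rewrite distrC; apply => //.
  - by move=> i j _ _ _; rewrite !ord1.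
  - by move: xy; rewrite /= distrC ger0_norm// subr_ge0.
apply => //.
- by move=> _; rewrite cy xd (ltW yltx).
- by move=> i j _ _ _; rewrite !ord1.
- by move: xy; rewrite /= ger0_norm// subr_ge0 ltW.
Qed.

Lemma abs_cont_IVT c d P k : c <= d -> abs_cont c d P -> P d <= k <= P c ->
  exists2 x, c <= x <= d & P x = k.
Proof.
move=> cd /abs_cont_continuous cP /andP[dk kc].
have [|x] := IVT (v := k) cd cP; last by rewrite in_itv/=; exists x.
by rewrite ge_min le_max dk kc orbT.
Qed.


End DerivativesAndAbsoluteContinuity.

(** * A Fatou-type inequality *)

Section LebesgueIntegral.
Context {R : realType}.
Implicit Types (P phi : R -> R) (p r x : R).

Lemma leb_measurable_itv (i : interval R) :
  @measurable _ (lebR R) [set` i].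
Proof. by apply: sub_caratheodory; exact: measurable_itv. Qed.

Lemma leb_measurable_open (A : set R) : open A -> @measurable _ (lebR R) A.
Proof.
by move=> oA; apply: sub_caratheodory; exact: open_measurable.
Qed.

Lemma leb_itv (i : interval R) :
  leb [set` i] = (if i.1 < i.2 then (i.2 : \bar R) - i.1 else 0)%E.
Proof. exact: lebesgue_measure_itv. Qed.

Lemma leb_itvcc p r : p <= r -> leb `[p, r] = (r - p)%:E.
Proof.
move=> pr; rewrite leb_itv/= lte_fin; case: ltP => // rp.
by have -> : p = r; [lra|rewrite subrr].
Qed.

(* Fatou's lemma for the difference quotients of P over uniform partitions,
   whose integrals all telescope to P p - P r. *)
Lemma integral_le_drop p r P phi : p < r ->
  (forall x y, p <= x -> x <= y -> y <= r -> P y <= P x) ->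
  (forall x, p <= x <= r -> 0 <= phi x) ->
  leb_measurable_fun `[p, r] phi ->
  {ae leb, forall x : R, p < x < r ->
    exists2 l, l <= - phi x & deriv_at P x l} ->
  (\int[leb]_(x in `[p, r]) (phi x)%:E <= (P p - P r)%:E)%E.
Proof.
move=> pr Pni phi0 mphi aeP.
pose hh (n : nat) := (r - p) / n.+1%:R.
pose X n k := p + k%:R * hh n.
have hh0 n : 0 < hh n by rewrite divr_gt0// subr_gt0.
have hhn n : n.+1%:R * hh n = r - p by rewrite mulrC divfK.
have X0 n : X n 0%N = p by rewrite /X mul0r addr0.
have XS n k : X n k.+1 = X n k + hh n by rewrite /X -natr1 mulrDl mul1r addrA.
have Xn n : X n n.+1 = r by rewrite /X hhn; ring.
have Xmono n k l : (k <= l)%N -> X n k <= X n l.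
  by move=> kl; rewrite lerD2l ler_pM2r// ler_nat.
have Xp n k : p <= X n k by rewrite -(X0 n); exact: Xmono.
have Xr n k : (k <= n.+1)%N -> X n k <= r by rewrite -(Xn n); exact: Xmono.
(* Half-open cells are disjoint, so [S n] equals a single quotient at each point; only the null set
   [{r}] stays uncovered. *)
pose I n k : set R := `[X n k, X n k.+1[%classic.
pose a n k := (P (X n k) - P (X n k.+1)) / hh n.
have a0 n k : (k < n.+1)%N -> 0 <= a n k.
  move=> kn; rewrite divr_ge0 ?(ltW (hh0 n))// subr_ge0.
  by apply: Pni; rewrite ?Xp ?Xmono ?Xr.
pose S n x : \bar R := (\sum_(k < n.+1) (a n k * \1_(I n k) x)%:E)%E.
have mI n k : @measurable _ (lebR R) (I n k) by exact: leb_measurable_itv.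
have S_step n k x : (k < n.+1)%N -> I n k x -> S n x = (a n k)%:E.
  move=> kn Ix; rewrite /S (bigD1 (Ordinal kn))//= big1 ?adde0.
    by rewrite indicE mem_set// mulr1.
  move=> j jk; rewrite indicE memNset ?mulr0//.
  move: Ix; rewrite /I /= !in_itv/= => /andP[k1 k2] /andP[j1 j2].
  have : (j : nat) != k by [].
  rewrite neq_ltn => /orP[/(Xmono n)|/(Xmono n)]; lra.
have cover n x : p <= x < r -> exists2 k, (k < n.+1)%N & I n k x.
  move=> /andP[px xr].
  have := @truncn_itv R ((x - p) / hh n).
  rewrite divr_ge0 ?subr_ge0 ?(ltW (hh0 n))// => /(_ isT)/andP[].
  set k := Num.truncn _.
  rewrite ler_pdivlMr// ltr_pdivrMr// => k1 k2.
  exists k.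
    rewrite -(ltr_nat R) -(ltr_pM2r (hh0 n)) hhn.
    by apply: (le_lt_trans k1); lra.
  by rewrite /I /= in_itv/= /X; lra.
have S0 n x : (0 <= S n x)%E.
  apply: sume_ge0 => k _; rewrite lee_fin mulr_ge0 ?a0//.
have mterm n k : measurable_fun (`[p, r] : set (lebR R))
    (fun x : lebR R => (a n k * \1_(I n k) x)%:E).
  by apply/measurable_EFinP; apply: measurable_funM.
have Xint n k : (k < n.+1)%N -> I n k `&` `[p, r] = I n k.
  move=> kn; apply/setIidPl => x; rewrite /I /= !in_itv/= => /andP[h1 h2].
  by rewrite (le_trans (Xp n k) h1) (le_trans (ltW h2))// Xr.
have intS n : (\int[leb]_(x in `[p, r]) S n x = (P p - P r)%:E)%E.
  rewrite (@ge0_integral_sum _ (lebR R) R leb _ (leb_measurable_itv _) _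
      (fun (k : 'I_n.+1) x => (a n k * \1_(I n k) x)%:E))//; last first.
    by move=> k x _; rewrite lee_fin mulr_ge0// a0.
  rewrite (eq_bigr (fun k : 'I_n.+1 => (P (X n k) - P (X n k.+1))%:E)).
    rewrite sumEFin; congr (_%:E).
    under eq_bigr do rewrite -opprB.
    rewrite sumrN -(big_mkord xpredT (fun k => P (X n k.+1) - P (X n k))).
    by rewrite telescope_sumr// X0 Xn opprB.
  move=> k _.
  rewrite (@integralZl_indic _ (lebR R) _ leb _ _ (fun=> I n k))//; last 2 first.
  - exact: leb_measurable_itv.
  - by rewrite ltNge a0.
  have -> : (\int[leb]_(x in `[p, r]) (\1_(I n k) x)%:E)%E = leb (I n k `&` `[p, r]).
    by apply: integral_indic => //; exact: leb_measurable_itv.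
  rewrite Xint// leb_itv/= lte_fin XS ltrDl hh0.
  by rewrite -EFinD -EFinM; congr (_%:E); rewrite /a XS; field; rewrite gt_eqF.
have mS n : measurable_fun (`[p, r] : set (lebR R)) (S n : lebR R -> \bar R).
  exact: emeasurable_fun_sum.
have mlimS : measurable_fun (`[p, r] : set (lebR R))
    (fun x : lebR R => limn_einf (S ^~ x)).
  have mE : measurable_fun (`[p, r] : set (lebR R))
      (fun x : lebR R => limn_esup (fun n => - S n x)%E).
    by apply: measurable_fun_limn_esup => n; exact: (measurableT_comp (f := -%E)).
  exact: (measurableT_comp (f := -%E) _ mE).
(* The cell around a point of differentiability shrinks to it, so the quotients tend to [- l], which
   is at least [phi x]. *)
have cvgS x l : p < x < r -> deriv_at P x l -> S n x @[n --> \oo] --> (- l)%:E.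
  move=> /andP[px xr] dP.
  apply/fine_cvgP; split.
    apply: nearW => n; rewrite /S sumEFin.
    by [].
  apply/cvgrPdist_le => e e0.
  have [delta d0 h] := deriv_at_straddle dP e0.
  have dpr : 0 < delta / (r - p) by rewrite divr_gt0// subr_gt0.
  near=> n.
  have hd : hh n < delta.
    have : n.+1%:R^-1 < delta / (r - p) by near: n; exact: (near_infty_natSinv_lt (PosNum dpr)).
    by rewrite ltr_pdivlMr ?subr_gt0// mulrC.
  have [|k kn Ik] := cover n x; first by rewrite (ltW px) xr.
  rewrite /= (S_step _ _ _ kn Ik)/=.
  move: Ik; rewrite /I/= in_itv/= => /andP[k1 k2].
  have := h (X n k) (X n k.+1).
  rewrite k1 (ltW k2) {1 3 4}XS addrAC subrr add0r => /(_ isT hd) hx.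
  rewrite -(ler_pM2r (hh0 n)) -[in leLHS](gtr0_norm (hh0 n)) -normrM.
  suff -> : (- l - a n k) * hh n = P (X n k.+1) - P (X n k) - l * hh n by [].
  by rewrite /a; field; rewrite gt_eqF.
have fat : (\int[leb]_(x in `[p, r]) limn_einf (S ^~ x) <=
    limn_einf (fun n => \int[leb]_(x in `[p, r]) S n x))%E.
  by apply: fatou => //; exact: leb_measurable_itv.
have intSE : (fun n => \int[leb]_(x in `[p, r]) S n x)%E = cst (P p - P r)%:E.
  by apply/funext => n; exact: intS.
move: fat; rewrite intSE (cvg_limn_einf_sup (cvg_cst _)).1.
apply: le_trans.
apply: ae_ge0_le_integral.
- exact: leb_measurable_itv.
- by move=> x; rewrite /= in_itv/= lee_fin; exact: phi0.
- exact/measurable_EFinP.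
- move=> x _; rewrite limn_einf_lim; apply: lime_ge; first exact: is_cvg_einfs.
  by apply: nearW => n; apply: le_ereal_inf_tmp => _ [k _ <-]; exact: S0.
- exact: mlimS.
- apply: filterS3 aeP (ae_neq p) (ae_neq r) => x hx xp xr.
  rewrite /= in_itv/= => /andP[px xr'].
  have pxr : p < x < r.
    by rewrite !lt_neqAle px xr' eq_sym; move/eqP: xp => ->; move/eqP: xr => ->.
  have [l ll dl] := hx pxr.
  by rewrite (cvg_limn_einf_sup (cvgS _ _ pxr dl)).1 lee_fin; lra.
Unshelve. all: by end_near. Qed.

End LebesgueIntegral.

(** * One integration of the equation *)

Section LocalEstimate.
Context {R : realType}.
Implicit Types (P phi : R -> R) (s p r x : R).

(** A mean value inequality: [P] plus [k] times the identity has nonpositive derivative almost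
    everywhere. *)
Lemma abs_cont_drop x y P k : x <= y -> abs_cont x y P ->
  {ae leb, forall z : R, x < z < y -> exists2 l, l <= - k & deriv_at P z l} ->
  k * (y - x) <= P x - P y.
Proof.
move=> xy acP aeP.
have : P y + k * id y <= P x + k * id x.
  apply: (abs_cont_nonincreasing (P := fun z => P z + k * id z)) => //.
    by apply: abs_cont_addZ => //; exact: abs_cont_id.
  apply: filterS aeP => z /[apply] -[l lk dl].
  exists (l + k * 1); first by lra.
  by apply: deriv_at_addZ => //; exact: deriv_at_id.
by rewrite /=; lra.
Qed.

(* With u j = (-1)^j w^(j), the sum u (m-1) + sum_i beta i * u (i-1) is
   nonincreasing even though u (m-1) alone need not be: its derivative absorbs
   the lower order terms of the equation. *)
Lemma local_estimate k (u : nat -> R -> R) (beta : nat -> R) phi s p r tau :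
  0 < tau -> s + k.+2%:R * tau = p -> p < r ->
  (forall j, (j < k.+2)%N -> abs_cont s r (u j)) ->
  (forall j, (j < k.+1)%N -> forall x, s < x < r ->
    deriv_at (u j) x (- u j.+1 x)) ->
  (forall j, (j < k.+2)%N -> forall x, s <= x <= r -> 0 <= u j x) ->
  (forall i, 0 <= beta i) ->
  (forall x, s <= x <= r -> 0 <= phi x) ->
  leb_measurable_fun `[p, r] phi ->
  {ae leb, forall x : R, s < x < r -> exists2 l,
    l <= - phi x + \sum_(1 <= i < k.+2) beta i * u i x &
    deriv_at (u k.+1) x l} ->
  (\int[leb]_(x in `[p, r]) (phi x)%:E <=
    (u 0%N s * (1 + \sum_(1 <= i < k.+2) beta i * tau ^+ (k.+2 - i))
      / tau ^+ k.+1)%:E)%E.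
Proof.
move=> tau0 tauE pr acu du u0 beta0 phi0 mphi aeu.
have sp : s < p by rewrite -tauE ltrDl mulr_gt0.
(* [beta] shifted by one, with weight 1 on the top derivative: for [j <= k] the derivative of
   [gam j * u j] is [- beta j.+1 * u j.+1], which cancels a term of the sum in [aeu]. *)
pose gam j := if j == k.+1 then 1 else beta j.+1.
have gamk : gam k.+1 = 1 by rewrite /gam eqxx.
have gamlt j : (j < k.+1)%N -> gam j = beta j.+1.
  by move=> jk; rewrite /gam ltn_eqF.
have gam0 j : 0 <= gam j by rewrite /gam; case: ifP.
pose P0 x := \sum_(0 <= j < k.+2) gam j * u j x.
have acP0 : abs_cont s r P0.
  by apply: abs_cont_sum => j; rewrite mem_index_iota => /acu.
have dP0 : {ae leb, forall x : R, s < x < r ->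
    exists2 l, l <= - phi x & deriv_at P0 x l}.
  apply: filterS aeu => x h sxr; have [l ll dl] := h sxr.
  exists (\sum_(0 <= j < k.+2) gam j * (if j == k.+1 then l else - u j.+1 x)).
    rewrite big_nat_recr//= gamk eqxx mul1r.
    move: ll; rewrite big_add1/= => ll.
    rewrite (eq_big_nat _ _ (F2 := fun j => - (beta j.+1 * u j.+1 x))).
      by rewrite sumrN; lra.
    by move=> j /andP[_ jk]; rewrite gamlt// ltn_eqF// mulrN.
  apply: deriv_at_sum => j; rewrite mem_index_iota /= => jk.
  case: eqP => [->//|/eqP jn]; apply: du => //.
  by rewrite ltn_neqAle jn.
have P0ni x y : s <= x -> x <= y -> y <= r -> P0 y <= P0 x.
  move=> sx xy yr; apply: abs_cont_nonincreasing => //.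
    exact: abs_cont_sub acP0.
  apply: filterS dP0 => z h xzy; have [|l ll dl] := h; first by lra.
  by exists l => //; have := phi0 z; lra.
have uni j x y : (j < k.+1)%N -> s <= x -> x <= y -> y <= r -> u j y <= u j x.
  move=> jk sx xy yr; apply: abs_cont_nonincreasing => //.
    by apply: (abs_cont_sub sx yr); apply: acu; rewrite ltnW.
  apply: aeW => z xzy; exists (- u j.+1 z); last by apply: du => //; lra.
  by rewrite oppr_le0 u0//; lra.
have P0p : P0 p <= u 0%N s * (1 + \sum_(1 <= i < k.+2) beta i * tau ^+ (k.+2 - i))
      / tau ^+ k.+1.
  (* On the piece after [s + j * tau], [u j] falls by at least [tau] times the final value of
     [u j.+1], because [u j.+1] is nonincreasing as long as it is not the top derivative. *)
  have step j : (j < k.+1)%N -> u j (s + j%:R * tau) * tau ^+ j <= u 0%N s.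
    elim: j => [_|j IH jk]; first by rewrite mul0r addr0 expr0 mulr1.
    apply: le_trans (IH (ltnW jk)).
    rewrite exprS mulrA; apply: ler_wpM2r; first by rewrite exprn_ge0// ltW.
    have tj : s + j%:R * tau <= s + j.+1%:R * tau.
      by rewrite lerD2l ler_pM2r// ler_nat.
    have sj : s <= s + j%:R * tau by rewrite lerDl mulr_ge0// ltW.
    have jr : s + j.+1%:R * tau <= r.
      apply: le_trans (ltW pr); rewrite -tauE lerD2l ler_pM2r// ler_nat.
      by rewrite ltnW// ltnW.
    have := @abs_cont_drop _ _ (u j) (u j.+1 (s + j.+1%:R * tau)) tj.
    have -> : s + j.+1%:R * tau - (s + j%:R * tau) = tau.
      by rewrite -natr1; ring.
    have uj0 : 0 <= u j (s + j.+1%:R * tau).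
      by apply: u0; [rewrite ltnW// ltnW|rewrite (le_trans sj tj)].
    move=> h; apply: le_trans (h _ _) _; last by lra.
      by apply: (abs_cont_sub sj jr); apply: acu; rewrite ltnW// ltnW.
    apply: aeW => z /andP[z1 z2]; exists (- u j.+1 z).
      by rewrite lerN2; apply: uni => //; rewrite ?ltW// (le_lt_trans sj).
    by apply: du; [exact: ltnW|rewrite (le_lt_trans sj z1) (lt_le_trans z2)].
  pose t := p - tau.
  have tE : t = s + k.+1%:R * tau by rewrite /t -tauE -[in LHS]natr1; ring.
  have st : s <= t by rewrite tE lerDl mulr_ge0// ltW.
  have tp : t <= p by rewrite gerBl ltW.
  have tr : t <= r by rewrite (le_trans tp) ?ltW.
  have ut j : (j < k.+1)%N -> u j t * tau ^+ j <= u 0%N s.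
    move=> jk; apply: le_trans (step j jk).
    apply: ler_wpM2r; first by rewrite exprn_ge0// ltW.
    apply: uni => //; first by rewrite lerDl mulr_ge0// ltW.
    by rewrite tE lerD2l ler_pM2r// ler_nat ltnW.
  (* The top derivative lacks monotonicity, so the last piece [[t, p]] treats all orders at once:
     [Q] has derivative [gam 0 * u 0 - P0], and [P0] is nonincreasing. *)
  pose Q x := \sum_(0 <= j < k.+1) gam j.+1 * u j x.
  have dropQ : (P0 p - gam 0%N * u 0%N t) * (p - t) <= Q t - Q p.
    apply: abs_cont_drop => //.
      apply: (abs_cont_sub st (ltW pr)); apply: abs_cont_sum => j.
      by rewrite mem_index_iota => jk; apply: acu; rewrite ltnW.
    apply: aeW => z /andP[tz zp].
    exists (\sum_(0 <= j < k.+1) gam j.+1 * - u j.+1 z).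
      have : P0 p <= P0 z by apply: P0ni; rewrite ?ltW// (le_lt_trans st).
      rewrite {2}/P0 big_nat_recl//=.
      have : gam 0%N * u 0%N z <= gam 0%N * u 0%N t.
        apply: ler_wpM2l => //; apply: uni => //; first exact: ltW.
        by rewrite ltW// (lt_trans zp).
      under [in X in _ -> _ -> X]eq_bigr do rewrite mulrN.
      by rewrite sumrN; lra.
    apply: deriv_at_sum => j; rewrite mem_index_iota => jk.
    by apply: du; [|rewrite (le_lt_trans st tz) (lt_trans zp)].
  have Qp : 0 <= Q p.
    rewrite /Q big_nat; apply: sumr_ge0 => j /= jk; rewrite mulr_ge0// u0//.
      exact: ltnW.
    by rewrite !ltW.
  have key : P0 p * tau <= gam 0%N * u 0%N t * tau + Q t.
    by move: dropQ; rewrite /t opprB addrCA subrr addr0; lra.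
  rewrite ler_pdivlMr ?exprn_gt0// exprS mulrA.
  apply: (@le_trans _ _ ((gam 0%N * u 0%N t * tau + Q t) * tau ^+ k)).
    by apply: ler_wpM2r => //; rewrite exprn_ge0// ltW.
  have -> : 1 + \sum_(1 <= i < k.+2) beta i * tau ^+ (k.+2 - i) =
      \sum_(0 <= j < k.+2) gam j * tau ^+ (k.+1 - j).
    rewrite [RHS]big_nat_recr//= subnn expr0 mulr1 gamk addrC big_add1/=.
    congr (_ + _); apply: eq_big_nat => j /andP[_ jk].
    by rewrite gamlt// subSS.
  rewrite big_nat_recl//= subn0 mulrDl mulrDr; apply: lerD.
    rewrite -mulrA -exprS -mulrA [leRHS]mulrCA; apply: ler_wpM2l => //.
    apply: ler_wpM2r; first by rewrite exprn_ge0// ltW.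
    by have := ut 0%N isT; rewrite expr0 mulr1.
  rewrite /Q mulr_suml mulr_sumr; apply: ler_sum_nat => j /andP[_ jk].
  rewrite -mulrA [leRHS]mulrCA; apply: ler_wpM2l => //.
  rewrite subSS -[in leLHS](subnKC (ltnSE jk)) exprD mulrA mulrC [leRHS]mulrC.
  by apply: ler_wpM2l; [rewrite exprn_ge0// ltW|exact: ut].
apply: (@le_trans _ _ (P0 p - P0 r)%:E).
  apply: integral_le_drop => //.
  - by move=> x y px; apply: P0ni; rewrite (le_trans _ px)// ltW.
  - by move=> x /andP[px xr]; apply: phi0; rewrite xr (le_trans _ px)// ltW.
  - by apply: filterS dP0 => x h /andP[px xr]; apply: h; rewrite xr (lt_trans sp).
rewrite lee_fin; apply: le_trans P0p; rewrite gerBl /P0 big_nat.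
apply: sumr_ge0 => j /= jk; rewrite mulr_ge0// u0// lexx andbT.
by rewrite ltW// (lt_trans sp).
Qed.

End LocalEstimate.

(** * The drop estimate on long intervals *)

Section DropEstimate.
Context {R : realType}.
Implicit Types (x y s p r : R).

Lemma ler_bernoulli x n : 0 <= x -> 1 + n%:R * x <= (1 + x) ^+ n.
Proof.
move=> x0; elim: n => [|n IH]; first by rewrite mul0r addr0.
rewrite exprS; apply: (@le_trans _ _ ((1 + x) * (1 + n%:R * x))).
  have : 0 <= n%:R * x * x by rewrite !mulr_ge0.
  by rewrite -natr1; lra.
by apply: ler_wpM2l => //; lra.
Qed.

Lemma expr_unbounded x y : 1 < x -> exists n, y <= x ^+ n.
Proof.
move=> x1; have x0 : 0 < x - 1 by lra.
pose n := Num.bound (`|y| / (x - 1)); exists n.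
have : 1 + n%:R * (x - 1) <= (1 + (x - 1)) ^+ n by apply: ler_bernoulli; lra.
rewrite addrCA subrr addr0; apply: le_trans.
have : `|y| / (x - 1) < n%:R.
  by apply: archi_boundP; rewrite divr_ge0// ltW.
by rewrite ltr_pdivrMr//; have := ler_norm y; lra.
Qed.

Lemma ler_subX x y n : 0 <= y -> y <= x -> (x - y) * x ^+ n <= x ^+ n.+1 - y ^+ n.+1.
Proof.
move=> y0 yx; rewrite mulrBl -exprS lerD2l lerN2 exprS.
apply: ler_wpM2l => //; apply: lerXn2r; rewrite ?nnegrE//; lra.
Qed.

Lemma ler_sub_expr x y n : 0 <= y -> y <= x -> (x - y) ^+ n.+1 <= x ^+ n.+1 - y ^+ n.+1.
Proof.
move=> y0 yx; apply: le_trans (ler_subX n y0 yx).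
rewrite exprS; apply: ler_wpM2l; first by lra.
by apply: lerXn2r; rewrite ?nnegrE//; lra.
Qed.

Lemma ler_addX x y n : 0 <= x -> 0 <= y ->
  (x + y) ^+ n <= 2 ^+ n * (x ^+ n + y ^+ n).
Proof.
move=> x0 y0; wlog yx : x y x0 y0 / y <= x.
  by move=> h; case: (leP y x) => [|/ltW] /h; [exact|rewrite addrC [y ^+ _ + _]addrC; exact].
apply: (@le_trans _ _ ((2 * x) ^+ n)).
  by apply: lerXn2r; rewrite ?nnegrE; lra.
by rewrite exprMn; apply: ler_wpM2l; rewrite ?exprn_ge0// lerDl exprn_ge0.
Qed.

(** This is [1 / (2 ^+ m * (1 / c1 + 2 / c2))] with [m = k + 2], [c1] for short intervals and [c2]
    for chains. The 2 over [c2] reflects the double overlap in a chain; [2 ^+ m] comes from the m-th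
    power of a sum. *)
Definition drop_const (k : nat) (kappa L : R) : R :=
  1 / (2 ^+ k.+2 * (1 / ((1 / (4 * k.+2%:R * L)) ^+ k.+1 / 2) +
    2 / ((kappa - 1) / (2 * k.+2%:R)) ^+ k.+1)).

Lemma drop_const_gt0 k kappa L : 1 < kappa -> 0 < L -> 0 < drop_const k kappa L.
Proof.
move=> k1 L0; have ? : 0 < kappa - 1 by rewrite subr_gt0.
have ? : 0 < k.+2%:R :> R by rewrite ltr0n.
have ? : 0 < (1 / (4 * k.+2%:R * L)) ^+ k.+1 / 2.
  by apply: divr_gt0 => //; apply: exprn_gt0; rewrite divr_gt0// !mulr_gt0.
have ? : 0 < ((kappa - 1) / (2 * k.+2%:R)) ^+ k.+1.
  by apply: exprn_gt0; rewrite divr_gt0// mulr_gt0.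
apply: divr_gt0 => //; apply: mulr_gt0; first by rewrite exprn_gt0.
by apply: addr_gt0; exact: divr_gt0.
Qed.

(* Phi ^ m plays the role of F(r), the integral of xi^(m-1) f(xi) from a to r,
   with m = k + 2. *)
Section Fixed.
Variables (k : nat) (kappa L : R) (w Phi : R -> R) (H a b : R).
Hypotheses (kappa1 : 1 < kappa) (kappa2 : kappa ^+ 2 <= 2) (L0 : 0 < L).
Hypotheses (a0 : 0 < a) (H0 : 0 <= H) (Phia : 0 < Phi a).
Let F x := Phi x ^+ k.+2.
Hypothesis Phi_nd : forall x y, a <= x -> x <= y -> y <= b -> Phi x <= Phi y.
Hypothesis F_lip : forall s p, a <= s -> s <= p -> p <= b ->
  F p - F s <= L * F p * (p - s) / s.
Hypothesis w_ni : forall x y, a <= x -> x <= y -> y <= b -> w y <= w x.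
Hypothesis w_drop : forall s p r, a <= s -> s < p -> p < r -> r <= b ->
  r <= kappa ^+ 2 * s ->
  H * ((p - s) / (k.+2%:R * r)) ^+ k.+1 * (F r - F p) <= w s - w r.

Let m : R := k.+2%:R.
(** Both constants use [2 * s / r >= 1], a consequence of [kappa ^+ 2 <= 2]. In [c1] the point [p]
    is adapted to the growth of [F]; in [c2] it is [kappa * s]. *)
Let c1 : R := (1 / (4 * m * L)) ^+ k.+1 / 2.
Let c2 : R := ((kappa - 1) / (2 * m)) ^+ k.+1.

Let m0 : 0 < m. Proof. by rewrite ltr0n. Qed.

Let PhiP x : a <= x -> x <= b -> 0 < Phi x.
Proof. by move=> ax xb; apply: lt_le_trans Phia _; exact: Phi_nd. Qed.

Let F_nd x y : a <= x -> x <= y -> y <= b -> F x <= F y.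
Proof.
move=> ax xy yb; apply: lerXn2r; rewrite ?nnegrE ?Phi_nd//.
  by rewrite ltW// PhiP// (le_trans xy).
by rewrite ltW// PhiP// (le_trans ax).
Qed.

Lemma drop_short s r : a <= s -> s <= r -> r <= b -> r <= kappa ^+ 2 * s ->
  c1 * H * (Phi r - Phi s) ^+ k.+2 <= w s - w r.
Proof.
move=> as_ sr rb rs.
have ar : a <= r := le_trans as_ sr.
have s0 : 0 < s := lt_le_trans a0 as_.
have r0 : 0 < r := lt_le_trans a0 ar.
have Phis : 0 < Phi s by apply: PhiP => //; exact: le_trans rb.
have Phir : 0 < Phi r by apply: PhiP.
have Fr : 0 < F r by rewrite exprn_gt0.
have [->|/eqP nPsr] := pselect (Phi s = Phi r).
  by rewrite subrr expr0n mulr0 subr_ge0 w_ni.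
have Psr : Phi s < Phi r by rewrite lt_neqAle nPsr Phi_nd.
have Psr0 : 0 < Phi r - Phi s by rewrite subr_gt0.
set dF := F r - F s.
have hdF : (Phi r - Phi s) * Phi r ^+ k.+1 <= dF by apply: ler_subX; exact: ltW.
have dF0 : 0 < dF by apply: lt_le_trans hdF; rewrite mulr_gt0// exprn_gt0.
have hlip : dF * s <= L * F r * (r - s).
  by have := F_lip as_ sr rb; rewrite ler_pdivlMr.
(* Chosen so that [F_lip] leaves at most half of the increment of [F] on [[s, p]] with
   [p = s + s * t]. Applied on [[s, r]], [F_lip] also puts [p] in the first half of that
   interval. *)
pose t := dF / (2 * (L * F r)).
have LF : 0 < L * F r by exact: mulr_gt0.
have t0 : 0 < t by apply: divr_gt0 => //; exact: mulr_gt0.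
have tE : L * F r * t = dF / 2.
  by rewrite /t; field; rewrite !gt_eqF.
pose p := s + s * t.
have sp : s < p by rewrite ltrDl mulr_gt0.
have pr : p < r.
  have h : 2 * (s * t) <= r - s.
    rewrite -(ler_pM2l (mulr_gt0 L0 Fr)); apply: le_trans hlip.
    have -> : L * F r * (2 * (s * t)) = 2 * s * (L * F r * t) by ring.
    by rewrite tE le_eqVlt; apply/orP; left; apply/eqP; field.
  by rewrite /p; move: (mulr_gt0 s0 t0); lra.
have Fp : F p - F s <= dF / 2.
  apply: (le_trans (F_lip as_ (ltW sp) (le_trans (ltW pr) rb))).
  have -> : L * F p * (p - s) / s = L * F p * t by rewrite /p; field; rewrite gt_eqF.
  rewrite -tE; apply: ler_wpM2r; first exact: ltW.
  apply: ler_wpM2l; first exact: ltW.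
  by apply: F_nd => //; [exact: le_trans (ltW sp)|exact: ltW].
apply: le_trans (w_drop as_ sp pr rb rs).
have hq : 1 / (4 * m * L) * ((Phi r - Phi s) / Phi r) <= (p - s) / (m * r).
  have -> : (p - s) / (m * r) = 1 / (4 * m * L) * (dF / F r * (2 * s / r)).
    by rewrite /p /t; field; rewrite !gt_eqF.
  apply: ler_wpM2l; first by rewrite divr_ge0// ltW// !mulr_gt0.
  have h1 : (Phi r - Phi s) / Phi r <= dF / F r.
    by rewrite ler_pdivlMr// /F exprS mulrA divfK// gt_eqF.
  apply: (le_trans h1); apply: ler_peMr; first by rewrite divr_ge0 ?ltW.
  rewrite ler_pdivlMr// mul1r; apply: (le_trans rs).
  by apply: ler_wpM2r => //; exact: ltW.
have hX : (1 / (4 * m * L)) ^+ k.+1 * ((Phi r - Phi s) / Phi r) ^+ k.+1 <=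
    ((p - s) / (m * r)) ^+ k.+1.
  rewrite -exprMn; apply: lerXn2r; rewrite ?nnegrE//.
    by rewrite mulr_ge0// divr_ge0// ltW// !mulr_gt0.
  by rewrite divr_ge0// ?mulr_ge0 ?ltW// subr_gt0.
have hF : dF / 2 <= F r - F p by rewrite /dF in Fp *; lra.
have B0 : 0 <= ((Phi r - Phi s) / Phi r) ^+ k.+1.
  by rewrite exprn_ge0// divr_ge0// ltW.
have A0 : 0 <= (1 / (4 * m * L)) ^+ k.+1.
  by rewrite exprn_ge0// divr_ge0// !mulr_ge0// ltW.
(* The lower bound [hdF] for [dF] supplies exactly the power of [Phi r] that the quotient lost. *)
have hY : (Phi r - Phi s) ^+ k.+2 <= ((Phi r - Phi s) / Phi r) ^+ k.+1 * dF.
  apply: le_trans (ler_wpM2l B0 hdF).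
  by rewrite mulrCA -exprMn divfK ?gt_eqF// exprS.
rewrite -[leRHS]mulrA [c1 * H]mulrC -[leLHS]mulrA; apply: ler_wpM2l => //.
apply: (@le_trans _ _ ((1 / (4 * m * L)) ^+ k.+1 *
    ((Phi r - Phi s) / Phi r) ^+ k.+1 * (dF / 2))).
  apply: (@le_trans _ _ (c1 * (((Phi r - Phi s) / Phi r) ^+ k.+1 * dF))).
    by apply: ler_wpM2l => //; exact: divr_ge0.
  rewrite /c1; move: (_ ^+ k.+1) (_ ^+ k.+1) => A B.
  by rewrite le_eqVlt; apply/orP; left; apply/eqP; field.
apply: ler_pM => //; first exact: mulr_ge0.
by rewrite divr_ge0// ltW.
Qed.

(* Consecutive intervals ]kappa^i s, kappa^(i+2) s[ overlap at most twice. *)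
Lemma drop_chain n s r : a <= s -> kappa * s <= r -> r <= b ->
  r <= kappa ^+ n.+2 * s ->
  c2 * H * (F r - F (kappa * s)) <= (w s - w r) + (w (kappa * s) - w r).
Proof.
have base s' r' : a <= s' -> kappa * s' <= r' -> r' <= b ->
    r' <= kappa ^+ 2 * s' ->
    c2 * H * (F r' - F (kappa * s')) <= w s' - w r'.
  move=> as_ ksr rb rs.
  have s0 : 0 < s' := lt_le_trans a0 as_.
  have sks : s' < kappa * s' by rewrite ltr_pMl.
  have r0 : 0 < r' by apply: (lt_le_trans s0); rewrite ltW// (lt_le_trans sks).
  have [<-|/eqP krn] := pselect (kappa * s' = r').
    rewrite subrr mulr0 subr_ge0; apply: w_ni => //; first exact: ltW.
    exact: le_trans rb.
  have kr : kappa * s' < r' by rewrite lt_neqAle krn.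
  apply: le_trans (w_drop as_ sks kr rb rs).
  apply: ler_wpM2r; first by rewrite subr_ge0 F_nd// (le_trans as_)// ltW.
  rewrite mulrC; apply: ler_wpM2l => //; apply: lerXn2r; rewrite ?nnegrE.
  - by rewrite divr_ge0// ?mulr_ge0// ?ltW// subr_gt0.
  - by rewrite divr_ge0// ?mulr_ge0// ?ltW// subr_gt0.
  have -> : (kappa * s' - s') / (k.+2%:R * r') = (kappa - 1) / (2 * m) * (2 * s' / r').
    by rewrite /m; field; rewrite !gt_eqF.
  apply: ler_peMr; first by rewrite divr_ge0// ?mulr_ge0// ?ltW// subr_gt0.
  rewrite ler_pdivlMr// mul1r; apply: (le_trans rs).
  by apply: ler_wpM2r => //; exact: ltW.
elim: n s => [|n IH] s as_ ksr rb rs.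
  apply: (le_trans (base _ _ as_ ksr rb rs)); rewrite lerDl subr_ge0 w_ni//.
  have s0 : 0 < s := lt_le_trans a0 as_.
  by apply: (le_trans as_); rewrite ler_peMl ?ltW.
have s0 : 0 < s := lt_le_trans a0 as_.
have sks : s < kappa * s by rewrite ltr_pMl.
have aks : a <= kappa * s by rewrite (le_trans as_)// ltW.
have [rs2|] := leP r (kappa ^+ 2 * s).
  apply: (le_trans (base _ _ as_ ksr rb rs2)); rewrite lerDl subr_ge0.
  exact: w_ni.
have -> : kappa ^+ 2 * s = kappa * (kappa * s) by rewrite expr2 mulrA.
move=> /ltW kksr.
have := IH (kappa * s) aks kksr rb.
rewrite mulrA -exprSr => /(_ rs) h1.
(* The induction hypothesis starts at [kappa * s] and misses this increment of [F]. The right-hand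
   sides of [h1] and [h2] then telescope to the claim. *)
have h2 : c2 * H * (F (kappa * (kappa * s)) - F (kappa * s)) <=
    w s - w (kappa * (kappa * s)).
  apply: base => //; last by rewrite expr2 mulrA.
    by rewrite ler_pM2l ?(lt_trans ltr01)// ltW.
  exact: le_trans rb.
have := lerD h1 h2; rewrite -mulrDr subrKA => /le_trans; apply.
by rewrite le_eqVlt; apply/orP; left; apply/eqP; ring.
Qed.

(** A chain from [a] only sees [F] beyond [kappa * a], so the increment of [Phi] is split there:
    [drop_short] covers the first part, [drop_chain] the second. Powers of increments of [Phi] are
    at most increments of [F]. *)
Lemma drop_estimate : a <= b -> drop_const k kappa L * H * (Phi b - Phi a) ^+ k.+2 <= w a - w b.
Proof.
move=> ab.
have k1 : 0 < kappa - 1 by rewrite subr_gt0.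
have c10 : 0 < c1 by rewrite divr_gt0// exprn_gt0// divr_gt0// !mulr_gt0.
have c20 : 0 < c2 by rewrite exprn_gt0// divr_gt0// mulr_gt0.
have c120 : 0 < 1 / c1 + 2 / c2 by rewrite addr_gt0// divr_gt0.
have two1 : 1 <= 2 ^+ k.+2 :> R by rewrite exprn_ege1// ler1n.
have Pab : Phi a <= Phi b by apply: Phi_nd.
have D0 : 0 <= w a - w b by rewrite subr_ge0 w_ni.
suff main : H * (Phi b - Phi a) ^+ k.+2 <=
    2 ^+ k.+2 * ((w a - w b) / c1 + 2 * (w a - w b) / c2).
  have d0 : 0 < 2 ^+ k.+2 * (1 / c1 + 2 / c2).
    by apply: mulr_gt0 => //; rewrite exprn_gt0.
  rewrite -mulrA /drop_const -/c1 -/c2 mul1r mulrC ler_pdivrMr//.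
  apply: (le_trans main); rewrite le_eqVlt; apply/orP; left; apply/eqP.
  by field; rewrite !gt_eqF.
have [short|long] := leP b (kappa ^+ 2 * a).
  have h : H * (Phi b - Phi a) ^+ k.+2 <= (w a - w b) / c1.
    by rewrite ler_pdivlMr// mulrC mulrA; exact: drop_short.
  apply: (le_trans h).
  have : 0 <= 2 * (w a - w b) / c2 by rewrite divr_ge0 ?mulr_ge0// ltW.
  have hh : 0 <= (w a - w b) / c1 by rewrite divr_ge0// ltW.
  move=> h2; apply: (@le_trans _ _ (1 * ((w a - w b) / c1 + 2 * (w a - w b) / c2))).
    by rewrite mul1r lerDl.
  by apply: ler_wpM2r => //; exact: addr_ge0.
have kab : kappa * a <= b.
  apply: le_trans (ltW long); rewrite expr2 -mulrA ler_peMl ?(ltW kappa1)//.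
  by rewrite mulr_ge0// ltW// (lt_trans ltr01).
have aka : a <= kappa * a by rewrite ler_peMl// ltW.
have [n hn] := expr_unbounded (b / a) kappa1.
have bn : b <= kappa ^+ n.+2 * a.
  rewrite -ler_pdivrMr//; apply: (le_trans hn); apply: ler_weXn2l; first exact: ltW.
  by rewrite leqW// leqW.
have h2 := drop_chain (lexx a) kab (lexx b) bn.
have h1 : c1 * H * (Phi (kappa * a) - Phi a) ^+ k.+2 <= w a - w (kappa * a).
  apply: drop_short => //; rewrite expr2 -mulrA; apply: ler_peMl; last exact: ltW.
  by rewrite mulr_ge0// ltW// (lt_trans ltr01).
have wk1 : w (kappa * a) <= w a by exact: w_ni.
have wk2 : w b <= w (kappa * a) by exact: w_ni.
have {}h1 : H * (Phi (kappa * a) - Phi a) ^+ k.+2 <= (w a - w b) / c1.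
  by rewrite ler_pdivlMr// mulrC mulrA; apply: (le_trans h1); lra.
have Pk : Phi a <= Phi (kappa * a) by exact: Phi_nd.
have Pk2 : Phi (kappa * a) <= Phi b by exact: Phi_nd.
have {}h2 : H * (Phi b - Phi (kappa * a)) ^+ k.+2 <= 2 * (w a - w b) / c2.
  rewrite ler_pdivlMr// mulrC mulrA.
  apply: (@le_trans _ _ (c2 * H * (F b - F (kappa * a)))).
    apply: ler_wpM2l; first by rewrite mulr_ge0// ltW.
    by apply: ler_sub_expr => //; rewrite ltW// PhiP.
  by apply: (le_trans h2); lra.
have := @ler_addX (Phi b - Phi (kappa * a)) (Phi (kappa * a) - Phi a) k.+2.
rewrite !subr_ge0 subrKA => /(_ Pk2 Pk) /(ler_wpM2l H0) h.
apply: (le_trans h); rewrite mulrCA; apply: ler_wpM2l; first by rewrite exprn_ge0.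
by rewrite mulrDr; lra.
Qed.

End Fixed.
End DropEstimate.

(** * From the drop of w to the growth of G_0(w) *)

Section Growth.
Context {R : realType}.
Variables (k : nat) (kappa L mu : R).
Hypotheses (kappa1 : 1 < kappa) (kappa2 : kappa ^+ 2 <= 2) (L0 : 0 < L).
Hypothesis mu1 : 1 < mu.

(** The minimum with 1 makes the power [k.+2] of the constant at most the constant itself, so no
    m-th root has to be taken. *)
Definition growth_const : R :=
  Num.min 1 (((mu - 1) / mu) ^+ k.+1 * drop_const k kappa L).

Let mu0 : 0 < mu. Proof. exact: lt_trans mu1. Qed.
Let q0 : 0 < (mu - 1) / mu. Proof. by rewrite divr_gt0// subr_gt0. Qed.
Let c3_gt0 : 0 < drop_const k kappa L. Proof. exact: drop_const_gt0. Qed.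

Lemma growth_const_gt0 : 0 < growth_const.
Proof. by rewrite lt_min ltr01 mulr_gt0// exprn_gt0. Qed.

Variables (w Phi E h : R -> R) (r0 : R).
Hypotheses (r0_gt0 : 0 < r0) (Phir0 : 0 < Phi r0).
Let F x := Phi x ^+ k.+2.
Hypothesis Phi_nd : forall x y, r0 <= x -> x <= y -> Phi x <= Phi y.
Hypothesis F_lip : forall s p, r0 <= s -> s <= p ->
  F p - F s <= L * F p * (p - s) / s.
Hypothesis w_ni : forall x y, r0 <= x -> x <= y -> w y <= w x.
Hypothesis w_ivt : forall x y t, r0 <= x -> x <= y -> w y <= t <= w x ->
  exists2 s, x <= s <= y & w s = t.
Hypothesis w_drop : forall H s p r, 0 <= H -> r0 <= s -> s < p -> p < r ->
  r <= kappa ^+ 2 * s -> 0 < w r -> (forall x, s <= x <= r -> H <= h (w x)) ->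
  H * ((p - s) / (k.+2%:R * r)) ^+ k.+1 * (F r - F p) <= w s - w r.
Hypothesis E_ni : forall x y, 0 < x -> x <= y -> E y <= E x.
(** [E] stands for G_0. [Y] and [Hm] are m-th roots of [y] and of a lower bound of [h] on [[x, y]];
    as witnesses they keep real exponents out of this section. *)
Hypothesis E_gain : forall x y, 0 < x -> x <= y -> y <= mu * x ->
  exists Hm Y, [/\ 0 < Hm, 0 < Y, Y ^+ k.+2 = y,
    forall t, x <= t <= y -> Hm ^+ k.+2 <= h t &
    Y / Hm * ((y - x) / y) <= E x - E y].

Let drop H s r : 0 <= H -> r0 <= s -> s <= r -> 0 < w r ->
  (forall t, w r <= t <= w s -> H <= h t) ->
  drop_const k kappa L * H * (Phi r - Phi s) ^+ k.+2 <= w s - w r.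
Proof.
move=> H0 rs sr wr Hh.
have s0 : 0 < s by exact: lt_le_trans rs.
apply: drop_estimate => //.
- by apply: lt_le_trans Phir0 _; exact: Phi_nd.
- by move=> x y sx xy _; apply: Phi_nd => //; exact: le_trans sx.
- by move=> x y sx xy _; apply: F_lip => //; exact: le_trans sx.
- by move=> x y sx xy _; apply: w_ni => //; exact: le_trans sx.
move=> x p y sx xp py yr yx.
have xy : x <= y by rewrite ltW// (lt_trans xp).
apply: w_drop => //; first exact: le_trans sx.
  apply: lt_le_trans wr _; apply: w_ni => //.
  by rewrite (le_trans rs)// (le_trans sx).
move=> z /andP[xz zy]; apply: Hh; apply/andP; split.
  by apply: w_ni; [rewrite (le_trans rs)// (le_trans sx)|exact: le_trans yr].
by apply: w_ni => //; exact: le_trans xz.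
Qed.

(** The values of [w] are climbed in steps of ratio [mu] up to [w r0]. Each step preserves the
    inequality with the same [K], so the number of steps does not matter. *)
Lemma growth : exists K, forall r, r0 <= r -> 0 < w r ->
  growth_const * Phi r - K <= E (w r).
Proof.
have [w0|w0] := leP (w r0) 0.
  exists 0 => r rr wr; have := w_ni (lexx r0) rr.
  by move=> /(lt_le_trans wr); rewrite ltNge w0.
(* While [w] has lost at most a factor [mu], a single lower bound of [h] keeps [Phi r] bounded, and
   a large [K] suffices. *)
have [K hK] : exists K, forall r, r0 <= r -> 0 < w r -> w r0 <= mu * w r ->
    growth_const * Phi r - K <= E (w r).
  have x0 : 0 < w r0 / mu by exact: divr_gt0.
  have [| |Hm [Y [Hm0 Y0 YE Hh _]]] := E_gain x0 (y := w r0).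
  - by rewrite ler_pdivrMr// ler_peMr// ltW.
  - by rewrite mulrC divfK// gt_eqF.
  set Z := w r0 / (drop_const k kappa L * Hm ^+ k.+2).
  exists (growth_const * (Phi r0 + (1 + Z)) - E (w r0)) => r rr wr wrm.
  have cH : 0 < drop_const k kappa L * Hm ^+ k.+2.
    by apply: mulr_gt0 => //; rewrite exprn_gt0.
  have Z0 : 0 <= Z by rewrite divr_ge0// ltW.
  have hZ : (Phi r - Phi r0) ^+ k.+2 <= Z.
    rewrite ler_pdivlMr// mulrC; apply: (@le_trans _ _ (w r0 - w r)); last first.
      by rewrite gerBl ltW.
    apply: drop => //; first by rewrite exprn_ge0// ltW.
    move=> t /andP[t1 t2]; apply: Hh; rewrite t2 andbT (le_trans _ t1)//.
    by rewrite ler_pdivrMr// mulrC.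
  (* A number above 1 is at most its own power, which replaces an m-th root of [Z]. *)
  have hP : Phi r - Phi r0 <= 1 + Z.
    have [P1|/ltW P1] := leP (Phi r - Phi r0) 1; first by rewrite (le_trans P1)// lerDl.
    apply: (@le_trans _ _ Z); last by rewrite lerDr.
    by apply: le_trans hZ; rewrite exprS ler_peMr// ?exprn_ege1// (le_trans _ P1).
  have := E_ni wr (w_ni (lexx r0) rr).
  have : growth_const * Phi r <= growth_const * (Phi r0 + (1 + Z)).
    by rewrite ler_pM2l ?growth_const_gt0//; rewrite lerBlDl in hP.
  by lra.
exists K => r rr wr.
have [n hn] := expr_unbounded (w r0 / w r) mu1.
have {hn} : w r0 <= mu ^+ n * w r by rewrite -ler_pdivrMr.
elim: n r rr wr => [|n IH] r rr wr hn.
  apply: hK => //; apply: (le_trans hn); rewrite expr0.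
  by apply: ler_wpM2r; exact: ltW.
have [hm|hm] := leP (w r0) (mu * w r); first exact: hK.
have wmu : w r <= mu * w r by rewrite ler_peMl// ltW.
have [|s /andP[rs sr] ws] := w_ivt (lexx r0) rr (t := mu * w r).
  by rewrite wmu ltW.
have ws0 : 0 < w s by rewrite ws mulr_gt0.
have := IH s rs ws0; rewrite {1}ws mulrA -exprSr => /(_ hn) IHs.
have [Hm [Y [Hm0 Y0 YE Hh gain]]] := E_gain wr wmu (lexx _).
have dP0 : 0 <= Phi r - Phi s by rewrite subr_ge0 Phi_nd.
have H0 : 0 < Hm ^+ k.+2 by rewrite exprn_gt0.
have hd : drop_const k kappa L * Hm ^+ k.+2 * (Phi r - Phi s) ^+ k.+2 <=
    (mu - 1) / mu * Y ^+ k.+2.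
  have -> : (mu - 1) / mu * Y ^+ k.+2 = w s - w r.
    by rewrite YE ws; field; rewrite gt_eqF.
  by apply: drop => //; [exact: ltW|rewrite ws].
have qE : (mu * w r - w r) / (mu * w r) = (mu - 1) / mu.
  by field; rewrite !gt_eqF.
rewrite qE in gain.
set q := (mu - 1) / mu in gain hd *.
have step : growth_const * (Phi r - Phi s) <= Y / Hm * q.
  have gc0 := growth_const_gt0.
  rewrite -(@ler_pXn2r _ k.+2)//; last 2 first.
  - by rewrite nnegrE; apply: mulr_ge0 => //; exact: ltW.
  - by rewrite nnegrE; apply: mulr_ge0; [apply: divr_ge0; exact: ltW|exact: ltW q0].
  have g1 : growth_const ^+ k.+2 <= q ^+ k.+1 * drop_const k kappa L.
    apply: (@le_trans _ _ growth_const); last by rewrite /growth_const ge_min lexx orbT.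
    rewrite exprS; apply: ler_piMr; first exact: ltW.
    by apply: exprn_ile1; [exact: ltW|rewrite /growth_const ge_min lexx].
  rewrite exprMn [leRHS]exprMn expr_div_n.
  apply: (@le_trans _ _ (q ^+ k.+1 * drop_const k kappa L * (Phi r - Phi s) ^+ k.+2)).
    by apply: ler_wpM2r => //; rewrite exprn_ge0.
  rewrite [leRHS]mulrAC ler_pdivlMr//.
  apply: (@le_trans _ _ (q ^+ k.+1 * (q * Y ^+ k.+2))).
    apply: le_trans (ler_wpM2l _ hd); last by rewrite exprn_ge0// (ltW q0).
    rewrite le_eqVlt; apply/orP; left; apply/eqP.
    by move: (_ ^+ k.+2) (_ ^+ k.+2) (_ ^+ k.+1) => A B C; ring.
  by rewrite mulrA -exprSr; move: (q ^+ _) (Y ^+ _) => A B; rewrite mulrC.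
rewrite ws in IHs.
have := le_trans step gain; rewrite mulrBr; lra.
Qed.

End Growth.

(** * Lebesgue integrals over intervals *)

Section IntervalIntegrals.
Context {R : realType}.
Implicit Types (phi : R -> R) (c d e k M : R).

Lemma leb_set1 c : leb [set c] = 0%E.
Proof. by have := leb_itv `[c, c]; rewrite set_itv1/= ltxx. Qed.

Lemma leb_measurable_sub (A B : set R) phi :
  @measurable _ (lebR R) B -> A `<=` B ->
  leb_measurable_fun B phi -> leb_measurable_fun A phi.
Proof. by move=> mB AB; apply: measurable_funS. Qed.

Lemma leb_measurable_itvcc c d c' d' phi : c <= c' -> d' <= d ->
  leb_measurable_fun `[c, d] phi -> leb_measurable_fun `[c', d'] phi.
Proof.
move=> cc' dd'; apply: leb_measurable_sub; first exact: leb_measurable_itv.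
by move=> x /=; rewrite !in_itv/= => /andP[h1 h2]; rewrite (le_trans cc')// (le_trans h2).
Qed.

Lemma leb_integral_split c e d phi : c <= e -> e <= d ->
  leb_measurable_fun `[c, d] phi -> (forall x, c <= x <= d -> 0 <= phi x) ->
  (\int[leb]_(x in `[c, d]) (phi x)%:E =
   \int[leb]_(x in `[c, e]) (phi x)%:E + \int[leb]_(x in `[e, d]) (phi x)%:E)%E.
Proof.
move=> ce ed mphi phi0.
have cdE : `[c, d]%classic = `[c, e]%classic `|` `]e, d]%classic :> set R.
  by apply: itv_bndbnd_setU; rewrite bnd_simp.
have mE x y : c <= x -> y <= d ->
    measurable_fun (`[x, y] : set (lebR R)) (fun t : lebR R => (phi t)%:E).
  by move=> cx yd; apply/measurable_EFinP; exact: leb_measurable_itvcc mphi.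
rewrite cdE ge0_integral_setU; last 5 first.
- exact: leb_measurable_itv.
- exact: leb_measurable_itv.
- by rewrite -cdE; exact: mE.
- by move=> x; rewrite -cdE /= in_itv/= => /phi0; rewrite lee_fin.
- by apply/disj_setPS => x [/=]; rewrite !in_itv/=; lra.
congr (_ + _)%E.
rewrite [RHS](@ge0_negligible_integral _ (lebR R) R leb _ [set e]).
- congr (integral _ _ _); apply/seteqP; split => x /=; rewrite !in_itv/=.
    by move=> /andP[ex xd]; split; [rewrite ltW|move=> xe; rewrite xe ltxx in ex].
  by move=> [/andP[ex xd] xe]; rewrite xd lt_neqAle ex andbT eq_sym; apply/andP; split => //; apply/eqP.
- by rewrite -set_itv1; exact: leb_measurable_itv.
- exact: leb_measurable_itv.
- exact: mE.
- move=> x; rewrite /= in_itv/= lee_fin => /andP[ex xd]; apply: phi0.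
  by rewrite xd (le_trans ce).
- exact: leb_set1.
Qed.

Lemma leb_integral_cst c d k : c <= d ->
  (\int[leb]_(x in `[c, d]) (cst k%:E) x = (k * (d - c))%:E)%E.
Proof.
move=> cd; transitivity (k%:E * leb `[c, d])%E; last by rewrite leb_itvcc.
by apply: integral_cst; exact: leb_measurable_itv.
Qed.

Lemma leb_integral_le c d phi M : c <= d ->
  leb_measurable_fun `[c, d] phi -> (forall x, c <= x <= d -> 0 <= phi x) ->
  0 <= M -> {ae leb, forall x : R, c <= x <= d -> phi x <= M} ->
  (\int[leb]_(x in `[c, d]) (phi x)%:E <= (M * (d - c))%:E)%E.
Proof.
move=> cd mphi phi0 M0 hM.
rewrite -(leb_integral_cst M cd).
apply: ae_ge0_le_integral.
- exact: leb_measurable_itv.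
- by move=> x; rewrite /= in_itv/= lee_fin; exact: phi0.
- exact/measurable_EFinP.
- by move=> x _; rewrite lee_fin.
- exact: measurable_cst.
- by apply: filterS hM => x hx; rewrite /= in_itv/= lee_fin.
Qed.

Lemma leb_integral_ge c d phi k : c <= d ->
  leb_measurable_fun `[c, d] phi -> 0 <= k -> (forall x, c <= x <= d -> k <= phi x) ->
  ((k * (d - c))%:E <= \int[leb]_(x in `[c, d]) (phi x)%:E)%E.
Proof.
move=> cd mphi k0 hk.
rewrite -(leb_integral_cst k cd).
apply: ge0_le_integral.
- exact: leb_measurable_itv.
- by move=> x _; rewrite lee_fin.
- exact: measurable_cst.
- exact/measurable_EFinP.
- by move=> x; rewrite /= in_itv/= lee_fin; exact: hk.
Qed.

Lemma leb_Rintegral_fineK c d phi : (forall x, c <= x <= d -> 0 <= phi x) ->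
  (\int[leb]_(x in `[c, d]) (phi x)%:E < +oo)%E ->
  (\int[leb]_(x in `[c, d]) phi x)%:E = (\int[leb]_(x in `[c, d]) (phi x)%:E)%E.
Proof.
move=> phi0 fin; rewrite /Rintegral fineK// ge0_fin_numE//.
by apply: integral_ge0 => x; rewrite /= in_itv/= lee_fin; exact: phi0.
Qed.

Lemma leb_Rintegral_split c e d phi : c <= e -> e <= d ->
  leb_measurable_fun `[c, d] phi -> (forall x, c <= x <= d -> 0 <= phi x) ->
  (\int[leb]_(x in `[c, d]) (phi x)%:E < +oo)%E ->
  \int[leb]_(x in `[c, d]) phi x =
  \int[leb]_(x in `[c, e]) phi x + \int[leb]_(x in `[e, d]) phi x.
Proof.
move=> ce ed mphi phi0; have E := leb_integral_split ce ed mphi phi0.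
have h1 : (0 <= \int[leb]_(x in `[c, e]) (phi x)%:E)%E.
  by apply: integral_ge0 => x; rewrite /= in_itv/= lee_fin => h; apply: phi0; lra.
have h2 : (0 <= \int[leb]_(x in `[e, d]) (phi x)%:E)%E.
  by apply: integral_ge0 => x; rewrite /= in_itv/= lee_fin => h; apply: phi0; lra.
rewrite /Rintegral E => fin.
have fin1 : (\int[leb]_(x in `[c, e]) (phi x)%:E < +oo)%E.
  by apply: le_lt_trans fin; rewrite leeDl.
have fin2 : (\int[leb]_(x in `[e, d]) (phi x)%:E < +oo)%E.
  by apply: le_lt_trans fin; rewrite leeDr.
by rewrite fineD// ge0_fin_numE.
Qed.

(** If [P] failed throughout the interval, an open set of measure below [d - c] would contain it. *)
Lemma leb_ae_in c d (P : R -> Prop) : c < d -> {ae leb, forall x : R, P x} ->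
  exists2 x, c < x < d & P x.
Proof.
move=> cd hP; have d0 : 0 < d - c by rewrite subr_gt0.
have [U [_ hU mU]] := ae_fail_open d0 hP.
apply: contrapT => nP.
have sub : `]c, d[ `<=` U.
  move=> x /=; rewrite in_itv/= => xcd; apply: hU => Px; apply: nP.
  by exists x.
have : (lebesgue_measure `]c, d[ <= lebesgue_measure U)%E by exact: le_outer_measure.
rewrite lebesgue_measure_itv/= lte_fin cd => /le_lt_trans/(_ mU).
by rewrite -EFinB ltxx.
Qed.

End IntervalIntegrals.

(** * Essential suprema *)

Section EssSup.
Context {R : realType}.
Implicit Types (D : set R) (f : R -> R).

Lemma ess_sup_on_sub D D' f : D `<=` D' -> (ess_sup_on D f <= ess_sup_on D' f)%E.
Proof.
move=> DD'; apply: le_ereal_inf_tmp => y /= hy; apply: ereal_inf_lbound => /=.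
by apply: filterS hy => r h /DD' /h.
Qed.

(** The infimum of the essential bounds is attained: bounds [1/(n+1)] above it hold off null sets,
    and countably many null sets form a null set. *)
Lemma ess_sup_on_ae D f : ess_sup_on D f \is a fin_num ->
  {ae leb, forall r : R, D r -> ((f r)%:E <= ess_sup_on D f)%E}.
Proof.
move=> fin; have h n : {ae leb, forall r : R, D r ->
    ((f r)%:E <= ess_sup_on D f + n.+1%:R^-1%:E)%E}.
  have : (ess_sup_on D f < ess_sup_on D f + n.+1%:R^-1%:E)%E.
    by rewrite lteDl// lte_fin invr_gt0.
  move=> /ereal_inf_lt[y /= hy /ltW yl].
  by apply: filterS hy => r h /h /le_trans; apply.
have := @ae_foralln _ (lebR R) R leb _ h.
apply: filterS => r hr Dr; apply/lee_addgt0Pr => e e0.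
near \oo => n.
apply: (le_trans (hr n Dr)); rewrite leeD2l// lee_fin ltW//.
by near: n; exact: (near_infty_natSinv_lt (PosNum e0)).
Unshelve. all: by end_near. Qed.

End EssSup.

(** * The functions f and F *)

Section Coefficients.
Context {R : realType}.
Variables (m : nat) (sigma a : R) (q : R -> R) (b : nat -> R -> R).
Hypotheses (sigma1 : 1 < sigma) (a0 : 0 < a).
Hypotheses (q0 : forall r, a <= r -> 0 <= q r) (q_loc : Linfty_loc a q).
Hypothesis b_loc : forall i, (1 <= i < m)%N ->
  (forall r, a <= r -> 0 <= b i r) /\ Linfty_loc a (b i).

Let dom (r : R) : set R := `]r / sigma, r * sigma[ `&` `[a, +oo[.
Let bsup i r := fine (ess_sup_on (dom r) (b i)).
Let den r := 1 + \sum_(1 <= i < m) r ^+ (m - i) * bsup i r.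

(** [fine] sends infinite values to 0, so finiteness is what gives [f_fun] its meaning. The interval
    inside [D] excludes a negative value, the bound on [D] excludes [+oo]. *)
Lemma ess_sup_on_fin i (D : set R) c d : (1 <= i < m)%N -> c < d ->
  `]c, d[ `<=` D -> (forall x, D x -> a <= x) -> (exists e, forall x, D x -> x <= e) ->
  ess_sup_on D (b i) \is a fin_num /\ 0 <= fine (ess_sup_on D (b i)).
Proof.
move=> im cd cdD Da [e De]; have [bi0 [_ bb]] := b_loc im.
have ess0 : (0 <= ess_sup_on D (b i))%E.
  apply: le_ereal_inf_tmp => y /= hy.
  have [x xcd hx] := leb_ae_in cd hy.
  have Dx : D x by apply: cdD; rewrite /= in_itv.
  by apply: le_trans (hx Dx); rewrite lee_fin bi0// Da.
have [x xcd _] := leb_ae_in (P := fun=> True) cd (aeW _ (fun=> I)).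
have Dx : D x by apply: cdD; rewrite /= in_itv.
have ae : a <= e by exact: le_trans (Da _ Dx) (De _ Dx).
have [M hM] := bb a e (lexx a) ae.
have essM : (ess_sup_on D (b i) <= M%:E)%E.
  apply: ereal_inf_lbound => /=; apply: filterS hM => r hr Dr; rewrite lee_fin.
  by apply: le_trans (ler_norm _) _; apply: hr; rewrite Da// De.
split; last exact: fine_ge0.
by rewrite ge0_fin_numE// (le_lt_trans essM)// ltry.
Qed.

Let dom_fin i r : (1 <= i < m)%N -> a <= r ->
  ess_sup_on (dom r) (b i) \is a fin_num /\ 0 <= bsup i r.
Proof.
move=> im ar; have r0 : 0 < r by exact: lt_le_trans ar.
(* At [r = a] the left half of the window is cut off; the right half always remains. *)
apply: (ess_sup_on_fin (c := r) (d := r * sigma)) => //.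
- by rewrite ltr_pMr.
- move=> x /=; rewrite in_itv/= => /andP[rx xr]; split; rewrite /= in_itv/=.
    rewrite xr andbT (le_lt_trans _ rx)// ler_pdivrMr ?(lt_trans ltr01)//.
    by rewrite ler_peMr// ltW.
  by rewrite andbT (le_trans ar)// ltW.
- by move=> x [_]; rewrite /= in_itv/= andbT.
- by exists (r * sigma) => x [] /=; rewrite in_itv/= => /andP[_ /ltW].
Qed.

Let den_ge1 r : a <= r -> 1 <= den r.
Proof.
move=> ar; rewrite /den lerDl big_nat; apply: sumr_ge0 => i im.
by rewrite mulr_ge0 ?exprn_ge0 ?(le_trans (ltW a0) ar)//; have [] := dom_fin im ar.
Qed.

Lemma f_fun_ge0 r : a <= r -> 0 <= f_fun m sigma a q b r.
Proof.
by move=> ar; apply: divr_ge0; [exact: q0|exact: le_trans ler01 (den_ge1 ar)].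
Qed.

Lemma f_fun_le r : a <= r -> f_fun m sigma a q b r <= q r.
Proof.
move=> ar; have d1 := den_ge1 ar.
rewrite /f_fun -/(den r) ler_pdivrMr ?(lt_le_trans ltr01 d1)//.
by rewrite ler_peMr// q0.
Qed.

(** Since [r < sigma * s], the window of each [x] in [[s, r]] contains [[s, r]]; so the essential
    suprema over [[s, r]] are at most those in the denominator of f(x). *)
Lemma coefficient_bounds s r : a <= s -> s < r -> r < sigma * s ->
  exists beta : nat -> R, [/\ forall i, 0 <= beta i,
    forall i, (1 <= i < m)%N ->
      {ae leb, forall x : R, s <= x <= r -> b i x <= beta i} &
    forall x, s <= x <= r ->
      (1 + \sum_(1 <= i < m) s ^+ (m - i) * beta i) * f_fun m sigma a q b x <= q x].
Proof.
move=> as_ sr rs; have s0 : 0 < s := lt_le_trans a0 as_.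
have sig0 : 0 < sigma := lt_trans ltr01 sigma1.
pose beta i := if (1 <= i < m)%N then fine (ess_sup_on `[s, r] (b i)) else 0.
have fin i : (1 <= i < m)%N ->
    ess_sup_on `[s, r] (b i) \is a fin_num /\ 0 <= fine (ess_sup_on `[s, r] (b i)).
  move=> im; apply: (ess_sup_on_fin (c := s) (d := r)) => //.
  - by move=> x /=; rewrite !in_itv/= => /andP[/ltW-> /ltW->].
  - by move=> x /=; rewrite in_itv/= => /andP[sx _]; exact: le_trans sx.
  - by exists r => x /=; rewrite in_itv/= => /andP[].
exists beta; split.
- by move=> i; rewrite /beta; case: ifP => // /fin[].
- move=> i im; rewrite /beta im; have [fi _] := fin i im.
  have := ess_sup_on_ae fi; apply: filterS => x h xsr.
  by rewrite -lee_fin fineK//; apply: h; rewrite /= in_itv.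
- move=> x /andP[sx xr]; have ax : a <= x by exact: le_trans sx.
  have d1 := den_ge1 ax; have x0 : 0 < x := lt_le_trans a0 ax.
  have -> : q x = den x * f_fun m sigma a q b x.
    by rewrite /f_fun -/(den x) mulrC divfK// gt_eqF// (lt_le_trans ltr01).
  apply: ler_wpM2r; first exact: f_fun_ge0.
  rewrite lerD2l; apply: ler_sum_nat => i im; rewrite /beta im.
  have [fi f0] := fin i im; have [gi g0] := dom_fin im ax.
  apply: ler_pM => //; first by rewrite exprn_ge0// ltW.
    by apply: lerXn2r; rewrite ?nnegrE// ltW.
  apply: fine_le => //; apply: ess_sup_on_sub => y /=.
  rewrite in_itv/= => /andP[sy yr]; split; rewrite /= in_itv/=.
    rewrite ltr_pdivrMr// (le_lt_trans xr)/=; last first.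
      by apply: (lt_le_trans rs); rewrite mulrC ler_pM2r.
    apply: (le_lt_trans yr); apply: (lt_le_trans rs).
    by rewrite mulrC ler_pM2r.
  by rewrite andbT (le_trans as_).
Qed.

(* Open intervals are exhausted by nearby ones, so [bsup i] is lower
   semicontinuous. *)
Let bsup_measurable i : (1 <= i < m)%N -> leb_measurable_fun `[a, +oo[ (bsup i).
Proof.
move=> im; have sig0 : 0 < sigma := lt_trans ltr01 sigma1.
apply: (measurability _ (RGenOInfty.measurableE R)).
move=> _ [_ [c ->] <-].
(* The implication holds vacuously to the left of [a], so [a] itself can be an interior point. *)
pose U := interior [set r : R | a <= r -> c < bsup i r].
have -> : `[a, +oo[ `&` bsup i @^-1` `]c, +oo[ = `[a, +oo[%classic `&` U.
  apply/seteqP; split => x /= [ax cx]; split => //; last first.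
    by have := nbhs_singleton cx; rewrite /= in_itv/= andbT; apply; move: ax; rewrite in_itv/= andbT.
  move: ax cx; rewrite !in_itv/= !andbT => ax cx.
  apply: contrapT => nU.
  (* If [x] is not interior, some [y n] tending to [x] have essential bound [c]. Each point of the
     window of [x] lies in the window of some [y n], so [c] bounds [b i] almost everywhere there
     too. *)
  have h (n : nat) : exists2 y, `|x - y| < n.+1%:R^-1 & a <= y /\ bsup i y <= c.
    apply: contrapT => hn; apply: nU; apply/nbhs_ballP.
    exists n.+1%:R^-1; first by rewrite /= invr_gt0.
    move=> y xy /= ay; rewrite ltNge; apply/negP => yc; apply: hn.
    by exists y.
  have {}h (n : nat) := cid2 (h n).
  pose y n := projT1 (h n).
  have hy n : `|x - y n| < n.+1%:R^-1 /\ a <= y n /\ bsup i (y n) <= c.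
    by rewrite /y; case: (h n).
  have aey n : {ae leb, forall t : R, dom (y n) t -> b i t <= c}.
    have [_ [ay yc]] := hy n; have [fi _] := dom_fin im ay.
    have := ess_sup_on_ae fi; apply: filterS => t ht Dt.
    by apply: le_trans yc; rewrite -lee_fin fineK//; exact: ht.
  have aex := @ae_foralln _ (lebR R) R leb _ aey.
  have : (ess_sup_on (dom x) (b i) <= c%:E)%E.
    apply: ereal_inf_lbound => /=; apply: filterS aex => t ht [/= Dt at_].
    move: Dt; rewrite in_itv/= => /andP[t1 t2]; rewrite lee_fin.
    have e0 : 0 < Num.min (t * sigma - x) (x - t / sigma).
      by rewrite lt_min !subr_gt0 ltr_pdivrMr// t2 -ltr_pdivrMr// t1.
    have [n _ hn] := near_infty_natSinv_lt (PosNum e0).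
    have := hn n (leqnn n); rewrite /= lt_min => /andP[n1 n2].
    apply: (ht n); split => //=; rewrite in_itv/=.
    have [+ _] := hy n; rewrite ltr_norml => /andP[y1 y2].
    rewrite ltr_pdivrMr// -[t < _]ltr_pdivrMr//.
    move: y1 y2 n1 n2; move: (_^-1) (t / sigma) (t * sigma) (y n) => u v z yn.
    by move=> *; apply/andP; split; lra.
  have [fi _] := dom_fin im ax.
  by rewrite -(fineK fi) lee_fin leNgt cx.
by apply: measurableI; [exact: leb_measurable_itv|apply: leb_measurable_open; exact: open_interior].
Qed.

Lemma F_integrand_measurable :
  leb_measurable_fun `[a, +oo[ (F_integrand m sigma a q b).
Proof.
have mid : leb_measurable_fun `[a, +oo[ (fun x : R => x).
  move=> mD Y mY; apply: measurableI => //; exact: sub_caratheodory.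
have mX n : leb_measurable_fun `[a, +oo[ (fun x : R => x ^+ n).
  exact: (@measurable_funX _ (lebR R) R _ (fun x => x) n mid).
pose term i (r : R) := if (1 <= i < m)%N then r ^+ (m - i) * bsup i r else 0.
have mden : leb_measurable_fun `[a, +oo[ den.
  rewrite /den; apply: measurable_funD => //.
  have -> : (fun r : R => \sum_(1 <= i < m) r ^+ (m - i) * bsup i r) =
      (fun r : R => \sum_(1 <= i < m) term i r).
    by apply/funext => r; apply: eq_big_nat => i im; rewrite /term im.
  apply: measurable_sum => i.
  have [im|/negbTE im] := boolP (1 <= i < m)%N; rewrite /term im; last first.
    exact: measurable_cst.
  have mb : leb_measurable_fun `[a, +oo[ (bsup i) by exact: bsup_measurable.
  by apply: measurable_funM; [exact: mX|exact mb].
(* The quotient is rewritten with a real power, whose measurability is known; [den] is positive on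
   the domain. *)
have E : {in (`[a, +oo[%classic : set R), (fun r : R => r ^+ m.-1 * (q r * (den r `^ (-1)))) =1
    F_integrand m sigma a q b}.
  move=> r; rewrite inE/= in_itv/= andbT => ar.
  by rewrite /F_integrand /f_fun -/(den r) powR_inv1// (le_trans ler01 (den_ge1 ar)).
apply: (@eq_measurable_fun _ _ (lebR R) R _ _ _ E).
apply: measurable_funM; first exact: mX.
apply: measurable_funM; first by case: q_loc.
exact: (measurableT_comp (@measurable_powR R (-1))).
Qed.

Lemma F_integrand_ge0 r : a <= r -> 0 <= F_integrand m sigma a q b r.
Proof.
move=> ar; rewrite mulr_ge0 ?f_fun_ge0// exprn_ge0//.
exact: le_trans (ltW a0) ar.
Qed.

Let mF c d : a <= c -> leb_measurable_fun `[c, d] (F_integrand m sigma a q b).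
Proof.
move=> ac; apply: leb_measurable_sub F_integrand_measurable.
  exact: leb_measurable_itv.
by move=> x /=; rewrite !in_itv/= andbT => /andP[cx _]; exact: le_trans cx.
Qed.

Lemma F_integrand_fin c d : a <= c -> c <= d ->
  (\int[leb]_(x in `[c, d]) (F_integrand m sigma a q b x)%:E < +oo)%E.
Proof.
move=> ac cd; have [_ qb] := q_loc; have [M hM] := qb c d ac cd.
apply: (@le_lt_trans _ _ (d ^+ m.-1 * `|M| * (d - c))%:E); last exact: ltry.
apply: leb_integral_le => //; first exact: mF.
- by move=> x /andP[cx _]; apply: F_integrand_ge0; exact: le_trans cx.
- by rewrite mulr_ge0// exprn_ge0// (le_trans (ltW a0))// (le_trans ac).
apply: filterS hM => x hx /andP[cx xd]; have ax : a <= x by exact: le_trans cx.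
have x0 : 0 <= x by exact: le_trans (ltW a0) ax.
apply: ler_pM; rewrite ?exprn_ge0 ?f_fun_ge0//.
  by apply: lerXn2r; rewrite ?nnegrE// (le_trans x0).
apply: (le_trans (f_fun_le ax)); apply: (le_trans (ler_norm _)).
by apply: le_trans (ler_norm M); apply: hx; rewrite cx.
Qed.

Lemma F_int_sub s p : a <= s -> s <= p ->
  F_int m sigma a q b p - F_int m sigma a q b s =
  \int[leb]_(x in `[s, p]) F_integrand m sigma a q b x.
Proof.
move=> as_ sp; rewrite /F_int (leb_Rintegral_split as_ sp).
- by rewrite addrC addKr.
- exact: mF.
- by move=> x /andP[ax _]; exact: F_integrand_ge0.
- by apply: F_integrand_fin => //; exact: le_trans sp.
Qed.

Lemma F_int_subE s p : a <= s -> s <= p ->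
  (F_int m sigma a q b p - F_int m sigma a q b s)%:E =
  (\int[leb]_(x in `[s, p]) (F_integrand m sigma a q b x)%:E)%E.
Proof.
move=> as_ sp; rewrite F_int_sub// leb_Rintegral_fineK//.
  by move=> x /andP[sx _]; apply: F_integrand_ge0; exact: le_trans sx.
exact: F_integrand_fin.
Qed.

Lemma F_int_nd s p : a <= s -> s <= p ->
  F_int m sigma a q b s <= F_int m sigma a q b p.
Proof.
move=> as_ sp; rewrite -subr_ge0 -lee_fin F_int_subE//.
apply: integral_ge0 => x; rewrite /= in_itv/= lee_fin => /andP[sx _].
by apply: F_integrand_ge0; exact: le_trans sx.
Qed.

(** By monotone convergence along [[a, a + n]], a bounded F would have a finite total integral;
    monotonicity of F carries the bound [M] to all later points. *)
Lemma F_int_unbounded M :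
  (\int[leb]_(xi in `[a, +oo[) (F_integrand m sigma a q b xi)%:E = +oo)%E ->
  exists2 r1, a <= r1 & forall r, r1 <= r -> M <= F_int m sigma a q b r.
Proof.
move=> Foo; apply: contrapT => nM.
have bnd r : a <= r -> F_int m sigma a q b r <= M.
  move=> ar; rewrite leNgt; apply/negP => Mr; apply: nM; exists r => // p rp.
  by apply: (le_trans (ltW Mr)); exact: F_int_nd.
pose I n : set R := `[a, a + n%:R]%classic.
have UI : \bigcup_n I n = `[a, +oo[%classic.
  apply/seteqP; split => [x [n _] /=|x /=]; rewrite !in_itv/= ?andbT.
    by move=> /andP[].
  move=> ax.
  exists (Num.bound (x - a)) => //; rewrite /I /= in_itv/= ax/= -lerBlDl ltW//.
  by apply: archi_boundP; rewrite subr_ge0.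
have := @ge0_nondecreasing_set_cvg_integral _ (lebR R) R I
  (EFin \o F_integrand m sigma a q b) leb.
rewrite UI Foo => cv.
have {cv} : (\int[leb]_(x in I i) (EFin \o F_integrand m sigma a q b) x)%E
    @[i --> \oo] --> +oo%E.
  apply: cv.
  - move=> n p np; apply/subsetPset => x; rewrite /I /= !in_itv/= => /andP[-> h]/=.
    by apply: (le_trans h); rewrite lerD2l ler_nat.
  - by move=> n; exact: leb_measurable_itv.
  - by move=> n; apply/measurable_EFinP; exact: mF.
  - move=> n x; rewrite /I/= in_itv/= => /andP[ax _].
    by rewrite lee_fin F_integrand_ge0.
move=> /cvgeyPge/(_ (M + 1)) [N _ hN].
have an : a <= a + N%:R by rewrite lerDl.
have := hN N (leqnn N); rewrite /= -leb_Rintegral_fineK.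
- rewrite lee_fin => /le_trans/(_ (bnd _ an)).
  by rewrite gerDl ler10.
- by move=> x /andP[ax _]; exact: F_integrand_ge0.
- exact: F_integrand_fin.
Qed.

End Coefficients.

(** * The function G_0 *)

Section G0Properties.
Context {R : realType}.
Variables (m : nat) (theta : R) (h : R -> R).
Hypotheses (m2 : (2 <= m)%N) (theta1 : 1 < theta).
Hypothesis h0 : forall t, 0 < t -> 0 < h t.
Hypothesis h_cont : {within `]0, +oo[, continuous h}.

Let p : R := m%:R^-1.
Let g := g_fun theta h.
Let psi := G0_integrand m theta h.
Let G := G0 m theta h.

Let th0 : 0 < theta. Proof. exact: lt_trans theta1. Qed.
Let m0 : 0 < m%:R :> R. Proof. by rewrite ltr0n (leq_trans _ m2). Qed.
Let p0 : 0 < p. Proof. by rewrite invr_gt0. Qed.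
Let p1 : p <= 1.
Proof. by rewrite invf_le1// ler1n (leq_trans _ m2). Qed.

Lemma h_min x y : 0 < x -> x <= y ->
  exists2 c, x <= c <= y & forall t, x <= t <= y -> h c <= h t.
Proof.
move=> x0 xy.
have hc : {within `[x, y], continuous h}.
  apply: continuous_subspaceW h_cont => t /=; rewrite !in_itv/= andbT.
  by move=> /andP[xt _]; exact: lt_le_trans xt.
have [c] := EVT_min xy hc; rewrite in_itv/= => cxy hm.
by exists c => // t txy; apply: hm; rewrite in_itv.
Qed.

Let dom_lb t : 0 < t -> has_lbound [set h s | s in `]t / theta, theta * t[].
Proof.
move=> t0; exists 0 => _ [s + <-]; rewrite /= in_itv/= => /andP[ts _].
by apply/ltW/h0; apply: lt_trans ts; rewrite divr_gt0.
Qed.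

Lemma g_le t s : 0 < t -> t / theta < s < theta * t -> g t <= h s.
Proof.
by move=> t0 ts; apply: (ge_inf (dom_lb t0)); exists s; rewrite //= in_itv.
Qed.

Let in_dom t : 0 < t -> t / theta < t < theta * t.
Proof. by move=> t0; rewrite ltr_pdivrMr// ltr_pMr// theta1 ltr_pMl// theta1. Qed.

(** All windows of points of [[x, y]] lie in the compact interval [[x / theta, theta * y]], where
    [h] has a positive minimum. *)
Lemma g_lower x y : 0 < x -> x <= y ->
  exists2 c, 0 < c & forall t, x <= t <= y -> c <= g t.
Proof.
move=> x0 xy; have xt0 : 0 < x / theta by rewrite divr_gt0.
have xty : x / theta <= theta * y.
  have /andP[h1 h2] := in_dom (lt_le_trans x0 xy).
  apply: le_trans (ltW h2); apply: le_trans (ltW h1).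
  by rewrite ler_pM2r// invr_gt0.
have [c /andP[c1 _] hc] := h_min xt0 xty.
exists (h c); first by apply: h0; exact: lt_le_trans c1.
move=> t /andP[xt ty]; have t0 := lt_le_trans x0 xt.
apply: lb_le_inf.
  by exists (h t); exists t; rewrite //= in_itv/= in_dom.
move=> _ [s + <-]; rewrite /= in_itv/= => /andP[s1 s2]; apply: hc.
apply/andP; split.
  by apply: le_trans (ltW s1); rewrite ler_pM2r// invr_gt0.
by apply: (le_trans (ltW s2)); rewrite ler_pM2l.
Qed.

Let g_gt0 t : 0 < t -> 0 < g t.
Proof.
by move=> t0; have [c c0 hc] := g_lower t0 (lexx t); apply: lt_le_trans c0 _;
  apply: hc; rewrite lexx.
Qed.

(** Both exponents, [p - 1] and [- p], are nonpositive, so both factors of [psi] are nonincreasing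
    in their bases. *)
Lemma psi_bounds x y c H t : 0 < x -> x <= t <= y -> 0 < c -> c <= g t <= H ->
  y `^ (p - 1) / H `^ p <= psi t <= x `^ (p - 1) / c `^ p.
Proof.
move=> x0 /andP[xt ty] c0 /andP[cg gH].
have t0 : 0 < t := lt_le_trans x0 xt.
have g0 : 0 < g t := lt_le_trans c0 cg.
have H0 : 0 < H := lt_le_trans g0 gH.
have y0 : 0 < y := lt_le_trans t0 ty.
have anti u v : 0 < u -> u <= v -> v `^ (p - 1) <= u `^ (p - 1).
  move=> u0 uv; rewrite -opprB !powRN lef_pV2 ?posrE ?powR_gt0//; last first.
    exact: lt_le_trans uv.
  by apply: ge0_ler_powR; rewrite ?subr_ge0// nnegrE ltW// (lt_le_trans u0).
have mono u v : 0 < u -> u <= v -> (v `^ p)^-1 <= (u `^ p)^-1.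
  move=> u0 uv; rewrite lef_pV2 ?posrE ?powR_gt0//; last exact: lt_le_trans uv.
  by apply: ge0_ler_powR; rewrite ?(ltW p0)// nnegrE ltW// (lt_le_trans u0).
have -> : psi t = t `^ (p - 1) / g t `^ p.
  by rewrite /psi /G0_integrand -/p -/g powRN mulrC.
by apply/andP; split; apply: ler_pM; rewrite ?invr_ge0 ?powR_ge0 ?anti ?mono.
Qed.

Lemma psi_ge0 t : 0 <= psi t.
Proof. by rewrite mulr_ge0// powR_ge0. Qed.

(** [g] is upper semicontinuous: a point of the window where [h < c] stays in the window of every
    nearby [t]. *)
Let g_measurable : leb_measurable_fun `]0, +oo[ g.
Proof.
apply: (measurability _ (RGenInftyO.measurableE R)).
move=> _ [_ [c ->] <-].
pose U : set R := [set t | 0 < t /\ exists2 s, t / theta < s < theta * t & h s < c].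
have -> : `]0, +oo[ `&` g @^-1` `]-oo, c[ = U.
  apply/seteqP; split => t /=; rewrite !in_itv/= andbT.
    move=> [t0 gc]; split => //.
    have [|_ [s + <-] hsc] := inf_lt _ gc; last by rewrite /= in_itv/=; exists s.
    by exists (h t); exists t; rewrite //= in_itv/= in_dom.
  by move=> [t0 [s st sc]]; split => //; apply: le_lt_trans sc; exact: g_le.
apply: leb_measurable_open; rewrite openE => t [t0 [s /andP[s1 s2] sc]].
have s1' : t < s * theta by rewrite -ltr_pdivrMr.
have s2' : s / theta < t by rewrite ltr_pdivrMr// mulrC.
apply/nbhs_ballP; exists (Num.min t (Num.min (s * theta - t) (t - s / theta))).
  by rewrite /= !lt_min t0 !subr_gt0 s1' s2'.
move=> y; rewrite /ball/= !lt_min !ltr_norml => /and3P[/andP[_ y1] /andP[y2 _] /andP[_ y3]].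
split; first by lra.
exists s => //; rewrite ltr_pdivrMr// [theta * y]mulrC -[s < _]ltr_pdivrMr//.
by move: y2 y3; move: (s * theta) (s / theta) => u v *; apply/andP; split; lra.
Qed.

Lemma psi_measurable : leb_measurable_fun `]0, +oo[ psi.
Proof.
have mid : leb_measurable_fun `]0, +oo[ (fun x : R => x).
  move=> mD Y mY; apply: measurableI => //; exact: sub_caratheodory.
apply: measurable_funM.
  exact: (measurableT_comp (@measurable_powR R (- p)) g_measurable).
exact: (measurableT_comp (@measurable_powR R (p - 1)) mid).
Qed.

Let mpsi x y : 0 < x -> leb_measurable_fun `[x, y] psi.
Proof.
move=> x0; apply: leb_measurable_sub psi_measurable; first exact: leb_measurable_itv.
by move=> t /=; rewrite !in_itv/= andbT => /andP[xt _]; exact: lt_le_trans xt.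
Qed.

Lemma psi_upper x y : 0 < x -> x <= y ->
  exists2 M, 0 <= M & forall t, x <= t <= y -> psi t <= M.
Proof.
move=> x0 xy; have [c c0 hc] := g_lower x0 xy.
exists (x `^ (p - 1) / c `^ p); first by rewrite divr_ge0 ?powR_ge0.
move=> t txy; have [|_ //] := andP (psi_bounds x0 txy c0 _ (H := g t)).
by rewrite hc//=.
Qed.

Let psi_fin x y : 0 < x -> x <= y ->
  (\int[leb]_(t in `[x, y]) (psi t)%:E < +oo)%E.
Proof.
move=> x0 xy; have [M M0 hM] := psi_upper x0 xy.
apply: (@le_lt_trans _ _ (M * (y - x))%:E); last exact: ltry.
apply: leb_integral_le => //; [exact: mpsi|by move=> *; exact: psi_ge0|].
exact: aeW.
Qed.

Lemma G0_sub x y : 0 < x -> x <= y -> G x - G y = \int[leb]_(t in `[x, y]) psi t.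
Proof.
move=> x0 xy; have y0 := lt_le_trans x0 xy.
have split u v w : 0 < u -> u <= v -> v <= w -> \int[leb]_(t in `[u, w]) psi t =
    \int[leb]_(t in `[u, v]) psi t + \int[leb]_(t in `[v, w]) psi t.
  move=> u0 uv vw; apply: leb_Rintegral_split => //; first exact: mpsi.
    by move=> *; exact: psi_ge0.
  by apply: psi_fin => //; exact: le_trans vw.
rewrite /G /G0 -/psi; case: (leP x 1) => [x1|/ltW x1]; case: (leP y 1) => [y1|/ltW y1].
- by have := split x y 1 x0 xy y1; lra.
- by have := split x 1 y x0 x1 y1; lra.
- have -> : x = 1 by apply/le_anti; rewrite x1 (le_trans xy).
  have -> : y = 1 by apply/le_anti; rewrite y1 (le_trans x1).
  by have := split 1 1 1 ltr01 (lexx _) (lexx _); lra.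
- by have := split 1 x y ltr01 x1 xy; lra.
Qed.

Lemma G0_ge x y k : 0 < x -> x <= y -> 0 <= k ->
  (forall t, x <= t <= y -> k <= psi t) -> k * (y - x) <= G x - G y.
Proof.
move=> x0 xy k0 hk; rewrite G0_sub// -lee_fin leb_Rintegral_fineK; last 2 first.
- by move=> *; exact: psi_ge0.
- exact: psi_fin.
by apply: leb_integral_ge => //; exact: mpsi.
Qed.

Lemma G0_le x y M : 0 < x -> x <= y -> 0 <= M ->
  (forall t, x <= t <= y -> psi t <= M) -> G x - G y <= M * (y - x).
Proof.
move=> x0 xy M0 hM; rewrite G0_sub// -lee_fin leb_Rintegral_fineK; last 2 first.
- by move=> *; exact: psi_ge0.
- exact: psi_fin.
by apply: leb_integral_le => //; [exact: mpsi|by move=> *; exact: psi_ge0|exact: aeW].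
Qed.

(** The ratio [y / x] is below [theta], so the point where [h] is minimal on [[x, y]] lies in the
    window of every [t] there. Hence [g] is at most that minimum, which bounds [psi] below. *)
Lemma G0_gain x y : 0 < x -> x <= y -> y * y <= theta * (x * x) ->
  exists Hm Y, [/\ 0 < Hm, 0 < Y, Y ^+ m = y,
    forall t, x <= t <= y -> Hm ^+ m <= h t &
    Y / Hm * ((y - x) / y) <= G x - G y].
Proof.
move=> x0 xy yx; have y0 := lt_le_trans x0 xy.
have [c /andP[xc cy] hc] := h_min x0 xy.
have c0 : 0 < c := lt_le_trans x0 xc.
have powK z : 0 <= z -> (z `^ p) ^+ m = z.
  by move=> z0; rewrite -powR_mulrn ?powR_ge0// -powRrM mulVf ?powRr1// gt_eqF.
exists (h c `^ p), (y `^ p); split.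
- by rewrite powR_gt0// h0.
- by rewrite powR_gt0.
- by rewrite powK// ltW.
- by move=> t txy; rewrite powK; [exact: hc|rewrite ltW// h0].
have -> : y `^ p / h c `^ p * ((y - x) / y) = y `^ (p - 1) / h c `^ p * (y - x).
  have -> : y `^ p = y * y `^ (p - 1) by rewrite mulr_powRB1// ltW.
  by field; rewrite !gt_eqF// powR_gt0// h0.
apply: G0_ge => //; first by rewrite divr_ge0// powR_ge0.
move=> t txy; have /andP[xt ty] := txy; have t0 := lt_le_trans x0 xt.
have [|//] := andP (psi_bounds x0 txy (g_gt0 t0) _ (H := h c)).
rewrite lexx/=; apply: g_le => //; rewrite ltr_pdivrMr//.
have lt_sq u v : 0 < u -> 0 < v -> x <= v -> u <= y -> u < theta * v.
  move=> u0 v0 xv uy; apply: (le_lt_trans uy).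
  rewrite ltNge; apply/negP => hle.
  have h1 : theta * x <= y by apply: le_trans hle; rewrite ler_pM2l.
  have h2 : theta * x * (theta * x) <= y * y by apply: ler_pM => //; rewrite mulr_ge0// ltW.
  have : theta * (x * x) < theta * x * (theta * x).
    rewrite mulrACA -[ltLHS]mul1r mulrA ltr_pM2r ?mulr_gt0//.
    by rewrite ltr_pM2r// mul1r.
  by lra.
apply/andP; split; last exact: lt_sq.
by rewrite mulrC; exact: lt_sq.
Qed.

Lemma G0_decreasing x y : 0 < x -> x < y -> G y < G x.
Proof.
move=> x0 xy; have y0 := lt_trans x0 xy.
have hc : {within `[x, y], continuous h}.
  apply: continuous_subspaceW h_cont => t /=; rewrite !in_itv/= andbT.
  by move=> /andP[xt _]; exact: lt_le_trans xt.
have [M Mxy hM] := EVT_max (ltW xy) hc.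
have M0 : 0 < h M.
  by apply: h0; move: Mxy; rewrite in_itv/= => /andP[xM _]; exact: lt_le_trans xM.
rewrite -subr_gt0; apply: lt_le_trans (G0_ge x0 (ltW xy) (k := y `^ (p - 1) / h M `^ p) _ _).
- by rewrite mulr_gt0 ?subr_gt0// divr_gt0// powR_gt0.
- by rewrite divr_ge0// powR_ge0.
move=> t txy; have /andP[xt ty] := txy; have t0 := lt_le_trans x0 xt.
have [|//] := andP (psi_bounds x0 txy (g_gt0 t0) _ (H := h M)).
rewrite lexx/=; apply: le_trans (hM t _); last by rewrite in_itv.
by apply: g_le => //; exact: in_dom.
Qed.

Lemma G0_nonincreasing x y : 0 < x -> x <= y -> G y <= G x.
Proof.
by move=> x0; rewrite le_eqVlt => /orP[/eqP->//|/(G0_decreasing x0)/ltW].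
Qed.

Lemma G0_unbounded M :
  (\int[leb]_(t in `]0%R, 1%R[) (psi t)%:E = +oo)%E ->
  exists2 x, 0 < x <= 1 & M <= G x.
Proof.
move=> Goo; apply: contrapT => nM.
have bnd x : 0 < x <= 1 -> G x <= M.
  by move=> x01; rewrite leNgt; apply/negP => /ltW Mx; apply: nM; exists x.
pose I (n : nat) : set R := `[n.+1%:R^-1, 1]%classic.
have UI : \bigcup_n I n = `]0, 1]%classic.
  apply/seteqP; split => [x [n _]|x]; rewrite /I /= !in_itv/=.
    by move=> /andP[nx ->]; rewrite (lt_le_trans _ nx)// invr_gt0.
  move=> /andP[x0 x1]; have [n _ hn] := near_infty_natSinv_lt (PosNum x0).
  by exists n => //; rewrite /I /= in_itv/= x1 andbT ltW//; apply: hn => /=.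
have m01 : leb_measurable_fun `]0, 1] psi.
  apply: leb_measurable_sub psi_measurable; first exact: leb_measurable_itv.
  by move=> t /=; rewrite !in_itv/= andbT => /andP[].
(* The closed intervals [I n] exhaust []0, 1]], whereas the hypothesis concerns []0, 1[]. *)
have Goo' : (\int[leb]_(t in `]0%R, 1%R]) (psi t)%:E = +oo)%E.
  apply/eqP; rewrite -leye_eq -Goo; apply: ge0_subset_integral.
  - exact: leb_measurable_itv.
  - exact: leb_measurable_itv.
  - exact/measurable_EFinP.
  - by move=> x _; rewrite lee_fin psi_ge0.
  - by move=> x /=; rewrite !in_itv/= => /andP[-> /ltW->].
have := @ge0_nondecreasing_set_cvg_integral _ (lebR R) R I (EFin \o psi) leb.
rewrite UI Goo' => cv.
have {cv} : (\int[leb]_(x in I i) (EFin \o psi) x)%E @[i --> \oo] --> +oo%E.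
  apply: cv.
  - move=> n k nk; apply/subsetPset => x; rewrite /I /= !in_itv/= => /andP[h1 ->].
    by rewrite andbT (le_trans _ h1)// lef_pV2 ?posrE// ler_nat.
  - by move=> n; exact: leb_measurable_itv.
  - by move=> n; apply/measurable_EFinP; apply: mpsi; rewrite invr_gt0.
  - by move=> n x _; rewrite lee_fin psi_ge0.
move=> /cvgeyPge/(_ (M + 1)) [N _ hN].
have N1 : N.+1%:R^-1 <= 1 :> R by rewrite invf_le1// ler1n.
have N0 : 0 < N.+1%:R^-1 :> R by rewrite invr_gt0.
have := hN N (leqnn N); rewrite /= -leb_Rintegral_fineK.
- have := bnd N.+1%:R^-1; rewrite N0 N1 /G /G0 -/psi N1 => /(_ isT) h1.
  by rewrite lee_fin => /le_trans/(_ h1); rewrite gerDl ler10.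
- by move=> x _; exact: psi_ge0.
- exact: psi_fin.
Qed.

(** [G] vanishes at 1, is unbounded near 0 and is Lipschitz on compact subintervals, so intermediate
    values give every [y >= 0]. *)
Lemma G0_surj y :
  (\int[leb]_(t in `]0%R, 1%R[) (psi t)%:E = +oo)%E -> 0 <= y ->
  exists2 x, 0 < x & G x = y.
Proof.
move=> Goo y0; have [x /andP[x0 x1] yx] := G0_unbounded y Goo.
have G1 : G 1 = 0.
  have [M M0 hM] := psi_upper ltr01 (lexx 1).
  have := G0_sub ltr01 (lexx 1); rewrite subrr /G /G0 lexx => <-//.
have [M M0 hM] := psi_upper x0 x1.
have acG : abs_cont x 1 G.
  apply: (lipschitz_abs_cont M0) => u v xu uv v1.
  have u0 := lt_le_trans x0 xu.
  rewrite distrC ger0_norm ?subr_ge0 ?G0_nonincreasing//.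
  by apply: G0_le => // t tuv; apply: hM; lra.
have [|z /andP[xz _] Gz] := abs_cont_IVT x1 acG (k := y); first by rewrite G1 y0.
by exists z => //; exact: lt_le_trans xz.
Qed.

Lemma G0_invP y : [set G xi | xi in `]0, +oo[] y ->
  0 < G0_inv m theta h y /\ G (G0_inv m theta h y) = y.
Proof.
move=> hy; split; last by apply: pinvK; rewrite inE.
have surj : set_surj `]0, +oo[ [set G xi | xi in `]0, +oo[] G by [].
have : (`]0, +oo[%classic : set R) (G0_inv m theta h y).
  by apply: (surjpinv_image_sub surj); exists y.
by rewrite /= in_itv/= andbT.
Qed.

End G0Properties.

(** * Solutions *)

Section Solutions.
Context {R : realType}.

Lemma has_deriv_on_at (a x l : R) (P : R -> R) : a < x ->
  has_deriv_on a P x l -> deriv_at P x l.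
Proof.
move=> ax /cvgrPdist_le hP e e0; have := hP e e0.
rewrite near_withinE => -[d /= d0 hd].
exists (Num.min d (x - a)); first by rewrite lt_min d0 subr_gt0.
move=> y; rewrite lt_min => /andP[yd ya].
have [->|yx] := eqVneq y x; first by rewrite !subrr mulr0 subr0 normr0 mulr0.
have ay : a <= y by move: ya; rewrite ltr_norml => /andP[]; lra.
have := hd y; rewrite /ball_ /= distrC => /(_ yd yx).
rewrite in_itv/= andbT => /(_ ay) h.
have yx0 : y - x != 0 by rewrite subr_eq0.
have -> : P y - P x - l * (y - x) = - (l - (P y - P x) / (y - x)) * (y - x).
  by field.
by rewrite normrM normrN ler_wpM2r.
Qed.

Variables (k : nat) (sigma a : R) (Q : R -> 'rV[R]_k.+2 -> R) (q : R -> R).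
Variables (b : nat -> R -> R) (h : R -> R) (w : R -> R) (W : nat -> R -> R).
Hypotheses (sigma1 : 1 < sigma) (a0 : 0 < a).
Hypotheses (q0 : forall r, a <= r -> 0 <= q r) (q_loc : Linfty_loc a q).
Hypothesis b_loc : forall i, (1 <= i < k.+2)%N ->
  (forall r, a <= r -> 0 <= b i r) /\ Linfty_loc a (b i).
Hypothesis growthQ : growth_condition a Q q b h.
Hypothesis W0 : W 0%N = w.
Hypothesis W_deriv : forall i, (i.+1 < k.+2)%N ->
  forall r, a <= r -> has_deriv_on a (W i) r (W i.+1 r).
Hypothesis W_ac : forall i, (i < k.+2)%N -> loc_abs_cont a (W i).
Hypothesis W_top : {ae leb, forall r : R, a <= r ->
  has_deriv_on a (W k.+1) r (Q r (\row_(i < k.+2) W i r))}.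
Hypothesis W_sign : forall i, (i < k.+2)%N ->
  forall r, a <= r -> 0 <= (-1) ^+ i * W i r.

Lemma solution_nonincreasing x y : a <= x -> x <= y -> w y <= w x.
Proof.
move=> ax xy; rewrite -W0; apply: abs_cont_nonincreasing => //.
  by apply: W_ac => //; exact: le_trans xy.
apply: aeW => z /andP[xz _]; have az : a < z by exact: le_lt_trans xz.
exists (W 1%N z); last by apply: (has_deriv_on_at az); apply: W_deriv => //; exact: ltW.
by have := W_sign (i := 1) isT (ltW az); rewrite expr1 mulN1r oppr_ge0.
Qed.

Lemma solution_ivt x y t : a <= x -> x <= y -> w y <= t <= w x ->
  exists2 s, x <= s <= y & w s = t.
Proof.
move=> ax xy; apply: abs_cont_IVT => //; rewrite -W0.
by apply: W_ac => //; exact: le_trans xy.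
Qed.

Let F := F_int k.+2 sigma a q b.

(** [local_estimate] with [tau = (p - s) / m]. The factor [B] sits in [phi] through B f <= q and
    bounds the factor on the right, so it cancels. *)
Lemma solution_drop H s p r : 0 <= H -> a < s -> s < p -> p < r ->
  r <= 2 * s -> r < sigma * s -> 0 < w r ->
  (forall x, s <= x <= r -> H <= h (w x)) ->
  H * ((p - s) / (k.+2%:R * r)) ^+ k.+1 * (F r - F p) <= w s - w r.
Proof.
move=> H0 as_ sp pr rs2 rsig wr Hh.
have s0 : 0 < s := lt_trans a0 as_.
have sr : s < r := lt_trans sp pr.
have r0 : 0 < r := lt_trans s0 sr.
have [beta [beta0 hbeta hf]] :=
  coefficient_bounds sigma1 a0 q0 b_loc (ltW as_) sr rsig.
set B := 1 + _ in hf.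
have B0 : 0 < B.
  apply: ltr_wpDr => //; apply: sumr_ge0 => i _.
  by rewrite mulr_ge0// exprn_ge0// ltW.
(* Subtracting [w r] at order 0 leaves the derivatives unchanged and turns [u 0 s] into the drop of
   [w]. *)
pose u j x := if j == 0%N then w x - w r else (-1) ^+ j * W j x.
pose phi x := H * B / r ^+ k.+1 * F_integrand k.+2 sigma a q b x.
pose tau := (p - s) / k.+2%:R.
have tau0 : 0 < tau by rewrite divr_gt0// subr_gt0.
have tauE : s + k.+2%:R * tau = p by rewrite /tau mulrC divfK// addrC subrK.
have cst0 : 0 <= H * B / r ^+ k.+1.
  by rewrite divr_ge0 ?mulr_ge0 ?exprn_ge0// ltW.
have phi0 x : s <= x <= r -> 0 <= phi x.
  move=> /andP[sx _]; apply: mulr_ge0 => //.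
  by apply: F_integrand_ge0 => //; exact: le_trans (ltW as_) sx.
have phi_le x : s <= x <= r -> phi x <= q x * h (w x).
  move=> sxr; have /andP[sx xr] := sxr; have ax : a <= x := le_trans (ltW as_) sx.
  have f0 := f_fun_ge0 sigma1 a0 q0 b_loc ax.
  apply: (@le_trans _ _ (q x * H)); last by apply: ler_wpM2l; [exact: q0|exact: Hh].
  apply: le_trans (ler_wpM2r H0 (hf x sxr)).
  rewrite /phi /F_integrand /=; move: (f_fun _ _ _ _ _ _) f0 => f f0.
  have -> : H * B / r ^+ k.+1 * (x ^+ k.+1 * f) = B * f * H * (x ^+ k.+1 / r ^+ k.+1).
    have : r ^+ k.+1 != 0 by rewrite gt_eqF ?exprn_gt0.
    by move: (x ^+ _) (r ^+ _) => X V V0; field.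
  apply: ler_piMr; first by rewrite !mulr_ge0// ltW.
  rewrite ler_pdivrMr ?exprn_gt0// mul1r; apply: lerXn2r => //; rewrite nnegrE ltW//.
  exact: lt_le_trans sx.
have acu j : (j < k.+2)%N -> abs_cont s r (u j).
  move=> jk; have acW : abs_cont s r (W j).
    by apply: (@abs_cont_sub _ a r) (W_ac jk _ _) => //; rewrite ltW// (lt_trans as_).
  rewrite /u; have [j0|jn0] := eqVneq j 0%N.
    have := abs_cont_addZ (-1) acW (abs_cont_cst s r (w r)).
    by rewrite j0 W0; under eq_fun do rewrite mulN1r.
  have := abs_cont_addZ ((-1) ^+ j) (abs_cont_cst s r 0) acW.
  by under eq_fun do rewrite add0r.
have du_gen j x l : deriv_at (W j) x l ->
    deriv_at (u j) x ((-1) ^+ j * l).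
  move=> dW; rewrite /u; have [j0|jn0] := eqVneq j 0%N.
    have := deriv_at_addZ (-1) dW (deriv_at_cst (w r) x).
    by rewrite j0 W0 expr0 mul1r mulr0 addr0; under eq_fun do rewrite mulN1r.
  have := deriv_at_addZ ((-1) ^+ j) (deriv_at_cst 0 x) dW.
  by rewrite add0r; under eq_fun do rewrite add0r.
have du j : (j < k.+1)%N -> forall x, s < x < r -> deriv_at (u j) x (- u j.+1 x).
  move=> jk x /andP[sx xr]; have ax : a < x := lt_trans as_ sx.
  have -> : - u j.+1 x = (-1) ^+ j * W j.+1 x by rewrite /u /= exprS mulN1r mulNr opprK.
  by apply/du_gen/(has_deriv_on_at ax)/W_deriv => //; exact: ltW.
have u0 j : (j < k.+2)%N -> forall x, s <= x <= r -> 0 <= u j x.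
  move=> jk x /andP[sx xr]; have ax : a <= x := le_trans (ltW as_) sx.
  by rewrite /u; case: ifP => _; [rewrite subr_ge0 solution_nonincreasing|exact: W_sign].
have aeu : {ae leb, forall x : R, s < x < r -> exists2 l,
    l <= - phi x + \sum_(1 <= i < k.+2) beta i * u i x & deriv_at (u k.+1) x l}.
  have aeb : {ae leb, forall x : R, forall i, (1 <= i < k.+2)%N ->
      s <= x <= r -> b i x <= beta i}.
    apply: (@ae_foralln _ (lebR R) R leb) => i.
    have [im|im] := boolP (1 <= i < k.+2)%N; last by apply: aeW.
    by have := hbeta i im; apply: filterS => x hx _.
  apply: filterS2 aeb W_top => x hb hW /andP[sx xr].
  have ax : a < x := lt_trans as_ sx.
  have sxr : s <= x <= r by rewrite !ltW.
  exists ((-1) ^+ k.+1 * Q x (\row_(i < k.+2) W i x)); last first.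
    exact/du_gen/(has_deriv_on_at ax)/hW/ltW.
  have wx : 0 < W 0%N x.
    by rewrite W0; apply: lt_le_trans wr _; apply: solution_nonincreasing; rewrite ltW.
  have := growthQ (t := fun i => W i x) (ltW ax) wx.
  rewrite W0 => gq.
  have {}gq := gq (fun i im => W_sign (proj2 (andP im)) (ltW ax)).
  have hsum : \sum_(1 <= i < k.+2) b i x * `|W i x| <=
      \sum_(1 <= i < k.+2) beta i * u i x.
    apply: ler_sum_nat => i im; have /andP[i1 ik] := im.
    have -> : u i x = `|W i x|.
      rewrite /u gtn_eqF// -(ger0_norm (W_sign ik (ltW ax))) normrM.
      by rewrite normrX normrN1 expr1n mul1r.
    by apply: ler_wpM2r => //; exact: hb.
  rewrite (exprS _ k.+1) mulN1r mulNr in gq.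
  by have := phi_le x sxr; lra.
have mphi : leb_measurable_fun `[p, r] phi.
  apply: measurable_funM; first exact: measurable_cst.
  apply: leb_measurable_sub (F_integrand_measurable sigma1 a0 q_loc b_loc).
    exact: leb_measurable_itv.
  move=> x /=; rewrite !in_itv/= andbT => /andP[px _].
  by rewrite (le_trans _ px)// ltW// (lt_trans as_).
have ap : a <= p by rewrite ltW// (lt_trans as_).
have := local_estimate tau0 tauE pr acu du u0 beta0 phi0 mphi aeu.
have -> : (\int[leb]_(x in `[p, r]) (phi x)%:E =
    (H * B / r ^+ k.+1 * (F r - F p))%:E)%E.
  rewrite EFinM (F_int_subE sigma1 a0 q0 q_loc b_loc ap (ltW pr)).
  transitivity (\int[leb]_(x in `[p, r]) ((H * B / r ^+ k.+1)%:E *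
      (F_integrand k.+2 sigma a q b x)%:E))%E; first by apply: eq_integral.
  apply: (@ge0_integralZl_EFin _ (lebR R) R leb) => //.
  - exact: leb_measurable_itv.
  - move=> x; rewrite /= in_itv/= lee_fin => /andP[px _].
    by apply: F_integrand_ge0 => //; exact: le_trans px.
  - apply/measurable_EFinP.
    apply: leb_measurable_sub (F_integrand_measurable sigma1 a0 q_loc b_loc).
      exact: leb_measurable_itv.
    move=> x /=; rewrite !in_itv/= andbT => /andP[px _]; exact: le_trans px.
rewrite lee_fin /u /= => est.
have D0 : 0 <= w s - w r.
  by rewrite subr_ge0; apply: solution_nonincreasing; exact: ltW.
(* Here [r <= 2 * s] is used: it gives [p - s <= s], hence [tau <= s]. *)
have hB : 1 + \sum_(1 <= i < k.+2) beta i * tau ^+ (k.+2 - i) <= B.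
  rewrite lerD2l; apply: ler_sum_nat => i _; rewrite mulrC; apply: ler_wpM2r => //.
  apply: lerXn2r; rewrite ?nnegrE ?(ltW tau0) ?(ltW s0)//.
  have : k.+2%:R * tau <= s by lra.
  apply: le_trans; rewrite ler_peMl ?(ltW tau0)//; by rewrite ler1n.
have {}est : H * B / r ^+ k.+1 * (F r - F p) <= (w s - w r) * B / tau ^+ k.+1.
  apply: (le_trans est); apply: ler_wpM2r; first by rewrite invr_ge0 exprn_ge0// ltW.
  exact: ler_wpM2l.
have tr0 : 0 < tau ^+ k.+1 / B by rewrite divr_gt0 ?exprn_gt0.
have := ler_wpM2l (ltW tr0) est.
have -> : tau ^+ k.+1 / B * ((w s - w r) * B / tau ^+ k.+1) = w s - w r.
  have : tau ^+ k.+1 != 0 by rewrite gt_eqF ?exprn_gt0.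
  by move: (tau ^+ _) => T T0; field; rewrite T0 gt_eqF.
apply: le_trans.
have -> : (p - s) / (k.+2%:R * r) = tau / r.
  by rewrite /tau; field; rewrite gt_eqF//= pnatr_eq0.
rewrite expr_div_n.
have : r ^+ k.+1 != 0 by rewrite gt_eqF ?exprn_gt0.
move: (tau ^+ _) (r ^+ _) => T V V0.
by rewrite le_eqVlt; apply/orP; left; apply/eqP; field; rewrite V0 gt_eqF.
Qed.

End Solutions.

(** * Growth rate of F under the limsup condition *)

Section FIntGrowth.
Context {R : realType}.
Variables (k : nat) (sigma a L r0 : R) (q : R -> R) (b : nat -> R -> R).
Hypotheses (sigma1 : 1 < sigma) (a0 : 0 < a) (ar0 : a <= r0) (L0 : 0 < L).
Hypotheses (q0 : forall r, a <= r -> 0 <= q r) (q_loc : Linfty_loc a q).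
Hypothesis b_loc : forall i, (1 <= i < k.+2)%N ->
  (forall r, a <= r -> 0 <= b i r) /\ Linfty_loc a (b i).
Let F := F_int k.+2 sigma a q b.
Hypothesis F0 : forall r, r0 <= r -> 0 < F r.
Hypothesis limF : forall r, r0 <= r ->
  r ^+ k.+2 * f_fun k.+2 sigma a q b r / F r <= L.

(** The integrand of F at x is at most L F(x) / x, hence at most L F(p) / s on [[s, p]]. *)
Lemma F_int_lipschitz s p : r0 <= s -> s <= p ->
  F p - F s <= L * F p * (p - s) / s.
Proof.
move=> rs sp; have as_ : a <= s := le_trans ar0 rs.
have s0 : 0 < s := lt_le_trans a0 as_.
have Fp : 0 < F p by apply: F0; exact: le_trans sp.
rewrite mulrAC -lee_fin (F_int_subE sigma1 a0 q0 q_loc b_loc as_ sp).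
apply: leb_integral_le => //.
- apply: leb_measurable_sub (F_integrand_measurable sigma1 a0 q_loc b_loc).
    exact: leb_measurable_itv.
  by move=> x /=; rewrite !in_itv/= andbT => /andP[sx _]; exact: le_trans sx.
- by move=> x /andP[sx _]; apply: F_integrand_ge0 => //; exact: le_trans sx.
- by rewrite divr_ge0 ?mulr_ge0// ltW.
apply: aeW => x /andP[sx xp]; have x0 : 0 < x := lt_le_trans s0 sx.
have rx : r0 <= x := le_trans rs sx.
have Fx : 0 < F x := F0 rx.
rewrite /F_integrand /=.
have -> : x ^+ k.+1 * f_fun k.+2 sigma a q b x =
    x ^+ k.+2 * f_fun k.+2 sigma a q b x / F x * (F x / x).
  rewrite (exprS x k.+1); move: (x ^+ k.+1) (f_fun _ _ _ _ _ _) => X f.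
  by field; rewrite !gt_eqF.
rewrite -[leRHS]mulrA; apply: (@le_trans _ _ (L * (F x / x))).
  by apply: ler_wpM2r; [rewrite divr_ge0// ltW|exact: limF].
apply: ler_wpM2l; first exact: ltW.
apply: ler_pM; rewrite ?invr_ge0 ?(ltW Fx) ?(ltW x0)//.
  by apply: F_int_nd => //; exact: le_trans rx.
by rewrite lef_pV2.
Qed.

End FIntGrowth.

Lemma limf_esup_le (R : realType) (u : R -> R) (L L' : R) :
  limf_esup (fun r => (u r)%:E) (pinfty_nbhs R) = L%:E -> L < L' ->
  exists M, forall r, M < r -> u r <= L'.
Proof.
move=> lim LL'.
have : (limf_esup (fun r => (u r)%:E) (pinfty_nbhs R) < L'%:E)%E by rewrite lim lte_fin.
move=> /ereal_inf_lt[_ [V [M [_ MV]] <-] supV].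
exists M => r Mr; rewrite -lee_fin; apply: le_trans (ltW supV).
by apply: ereal_sup_ubound; exists r => //; exact: MV.
Qed.

(** [C] is chosen before [a], [Q], [q], [b] and [h], which expresses its dependence on [m], [theta],
    [sigma] and [L] alone. That [y] lies in the range of G_0 is part of the conclusion, since
    [G0_inv] has meaning only there. *)
Theorem theorem2p3 (R : realType) (m : nat) (theta sigma L : R)
  (hm : (2 <= m)%N) (htheta : 1 < theta) (hsigma : 1 < sigma) :
  exists2 C : R, 0 < C &
  forall (a : R) (Q : R -> 'rV[R]_m -> R) (q : R -> R) (b : nat -> R -> R)
    (h : R -> R),
    0 < a ->
    K_loc a Q ->
    (forall r, a <= r -> 0 <= q r) -> Linfty_loc a q ->
    (forall i, (1 <= i < m)%N ->
      (forall r, a <= r -> 0 <= b i r) /\ Linfty_loc a (b i)) ->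
    (forall t, 0 < t -> 0 < h t) ->
    {within `]0, +oo[, continuous h} ->
    growth_condition a Q q b h ->
    (\int[leb]_(t in `]0%R, 1%R[) (G0_integrand m theta h t)%:E = +oo)%E ->
    (\int[leb]_(xi in `[a, +oo[) (F_integrand m sigma a q b xi)%:E = +oo)%E ->
    limf_esup (fun r : R =>
      (r ^+ m * f_fun m sigma a q b r / F_int m sigma a q b r)%:E)
      (pinfty_nbhs R) = L%:E ->
    forall w : R -> R, solution a Q w ->
    \forall r \near +oo,
      let y := C * F_int m sigma a q b r `^ m%:R^-1 in
      [set G0 m theta h xi | xi in `]0, +oo[] y /\ w r <= G0_inv m theta h y.
Proof.
case: m hm => [|[|k]]// m2.
(* Chosen so that [r <= kappa ^+ 2 * s] implies both [r < sigma * s] and [r <= 2 * s]. *)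
pose t := Num.min sigma 2; pose kappa := 1 + (t - 1) / 4.
have t1 : 1 < t by rewrite lt_min hsigma ltr1n.
have t2 : t <= 2 by rewrite ge_min lexx orbT.
have tsig : t <= sigma by rewrite ge_min lexx.
have kappa1 : 1 < kappa by rewrite /kappa; lra.
have kappa_t : kappa ^+ 2 < t.
  by rewrite /kappa expr2; clear -t1 t2; clearbody t; nra.
have kappa2 : kappa ^+ 2 <= 2 by rewrite ltW// (lt_le_trans kappa_t).
(* Positive and strictly above the limsup, hence an eventual bound for the quotient. *)
pose L' := `|L| + 1.
have L'0 : 0 < L' by rewrite ltr_wpDl.
have LL' : L < L' by rewrite (le_lt_trans (ler_norm L))// ltrDl.
pose mu := Num.sqrt theta.
have theta0 : 0 < theta by exact: lt_trans htheta.
have mu1 : 1 < mu by rewrite -[ltLHS]sqrtr1 ltr_sqrt.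
have muE : mu * mu = theta by rewrite -expr2 sqr_sqrtr// ltW.
pose c := growth_const k kappa L' mu.
have c0 : 0 < c by exact: growth_const_gt0.
(* The other half of [c * Phi r] absorbs [K] once [Phi r >= 2 * |K| / c], which is the threshold [N]
   below. *)
exists (c / 2); first by rewrite divr_gt0.
move=> a Q q b h a0 _ q0 q_loc b_loc h0 h_cont growthQ Goo Foo lim w.
move=> [W [W0 Wd Wac Wtop Wsign]].
set F := F_int k.+2 sigma a q b.
set G := G0 k.+2 theta h.
have [M hM] := limf_esup_le lim LL'.
have [r2 ar2 hr2] := F_int_unbounded hsigma a0 q0 q_loc b_loc 1 Foo.
(* The added 1 puts [r0] strictly above [a], where derivatives are two-sided, and strictly above
   [M]. *)
pose r0 := Num.max r2 (Num.max M a) + 1.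
have r2r0 : r2 < r0 by rewrite /r0; have : r2 <= Num.max r2 (Num.max M a) by [rewrite le_max lexx]; lra.
have Mr0 : M < r0.
  rewrite (@le_lt_trans _ _ (Num.max r2 (Num.max M a)))// ?ltrDl//.
  by rewrite !le_max lexx orbT.
have ar0 : a < r0 := le_lt_trans ar2 r2r0.
have r0_gt0 : 0 < r0 := lt_trans a0 ar0.
have F0 r : r0 <= r -> 0 < F r.
  by move=> rr; apply: (lt_le_trans ltr01); apply: hr2; rewrite (le_trans (ltW r2r0)).
have F_nd x y : r0 <= x -> x <= y -> F x <= F y.
  by move=> rx xy; apply: F_int_nd => //; rewrite (le_trans (ltW ar0)).
have limF r : r0 <= r -> r ^+ k.+2 * f_fun k.+2 sigma a q b r / F r <= L'.
  by move=> rr; apply: hM; exact: lt_le_trans rr.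
pose Phi r := F r `^ k.+2%:R^-1.
have PhiE r : Phi r = F r `^ k.+2%:R^-1 by [].
have Phi_ge0 r : 0 <= Phi r by exact: powR_ge0.
have Phi_gt0 r : r0 <= r -> 0 < Phi r by move=> rr; apply: powR_gt0; exact: F0.
have Phi_nd x y : r0 <= x -> x <= y -> Phi x <= Phi y.
  move=> rx xy; apply: ge0_ler_powR; rewrite ?invr_ge0 ?nnegrE// ?F_nd//.
    exact/ltW/F0.
  by apply/ltW/F0; exact: le_trans xy.
have PhiK r : r0 <= r -> Phi r ^+ k.+2 = F r.
  move=> rr; rewrite /Phi -powR_mulrn ?powR_ge0// -powRrM mulVf ?powRr1//.
  exact/ltW/F0.
(* Otherwise unification unfolds the integrals behind Phi. *)
clearbody Phi.
have [K hK] : exists K, forall r, r0 <= r -> 0 < w r -> c * Phi r - K <= G (w r).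
  apply: (growth kappa1 kappa2 L'0 mu1 r0_gt0 (h := h)).
  - exact: Phi_gt0.
  - exact: Phi_nd.
  - move=> s p rs sp; rewrite (PhiK s rs) (PhiK p (le_trans rs sp)).
    exact: (F_int_lipschitz hsigma a0 (ltW ar0) L'0 q0 q_loc b_loc F0 limF).
  - move=> x y rx xy; apply: (solution_nonincreasing W0 Wd Wac Wsign) => //.
    exact: le_trans (ltW ar0) rx.
  - move=> x y z rx xy; apply: (solution_ivt W0 Wac) => //.
    exact: le_trans (ltW ar0) rx.
  - move=> H s p r H0 rs sp pr rk wr Hh.
    have s0 : 0 < s := lt_le_trans r0_gt0 rs.
    have rp : r0 <= p by rewrite (le_trans rs)// ltW.
    rewrite (PhiK p rp) (PhiK r (le_trans rp (ltW pr))).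
    apply: (solution_drop hsigma a0 q0 q_loc b_loc growthQ W0 Wd Wac Wtop Wsign) => //.
    + exact: lt_le_trans rs.
    + by apply: (le_trans rk); rewrite ler_pM2r.
    + by apply: (le_lt_trans rk); rewrite ltr_pM2r// (lt_le_trans kappa_t).
  - by move=> x y x0 xy; exact: G0_nonincreasing.
  - move=> x y x0 xy yx; apply: G0_gain => //.
    rewrite -muE mulrACA; apply: ler_pM => //; rewrite ltW//; exact: lt_le_trans xy.
pose N := 2 * `|K| / c.
have N0 : 0 <= N by rewrite divr_ge0 ?mulr_ge0// ltW.
have [r3 ar3 hr3] := F_int_unbounded hsigma a0 q0 q_loc b_loc (N ^+ k.+2) Foo.
near=> r.
have rr0 : r0 <= r by near: r; apply: nbhs_pinfty_ge; exact: num_real.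
have rr3 : r3 <= r by near: r; apply: nbhs_pinfty_ge; exact: num_real.
have NPhi : N <= Phi r.
  by rewrite -(@ler_pXn2r _ k.+2) ?nnegrE// (PhiK r rr0) hr3.
set y := c / 2 * F r `^ _.
have y0 : 0 <= y by rewrite mulr_ge0 ?powR_ge0// divr_ge0// ltW.
have Gy : [set G xi | xi in `]0, +oo[] y.
  have [x x0 Gx] := G0_surj m2 htheta h0 h_cont Goo y0.
  by exists x => //; rewrite /= in_itv/= andbT.
split => //.
have [inv0 Ginv] := G0_invP Gy.
have [wr|wr] := leP (w r) 0; first exact: le_trans (ltW inv0).
rewrite leNgt; apply/negP => lt_inv.
have := G0_decreasing m2 htheta h0 h_cont inv0 lt_inv.
rewrite Ginv ltNge => /negP; apply.
apply: le_trans (hK r rr0 wr).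
have : c * N <= c * Phi r by rewrite ler_pM2l.
have -> : c * N = 2 * `|K| by rewrite /N mulrC divfK// gt_eqF.
have -> : y = c * Phi r / 2 by rewrite /y -PhiE mulrAC.
by have := ler_norm K; lra.
Unshelve. all: by end_near. Qed.
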